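(* Let $B$ and $C$ be finite-dimensional algebras over a field $k$, let $M$ be a finitely generated $C$-$B$-bimodule, and let $A=\begin{pmatrix} B & 0\\ {}_CM_B & C\end{pmatrix}$ be the triangular matrix algebra. If $X$ and $Y$ are respectively support $\tau$-tilting modules in $\operatorname{mod}B$ and $\operatorname{mod}C$, then $(X,0)\oplus(X_Y,Y)_f$ is a support $\tau$-tilting $A$-module, where $X_Y$ and $f$ are defined by the minimal left $\operatorname{Fac}X$-approximation $f:Y\otimes_C M\to X_Y$.
   Context: For a finite-dimensional algebra $A$ over a field, $\operatorname{mod}A$ is the category of finitely generated right $A$-modules, $\tau$ is the Auslander-Reiten translation, $|X|$ is the number of pairwise non-isomorphic indecomposable direct summands of $X$, and $\operatorname{Fac}X$ is the full subcategory of factor modules of finite direct sums of copies of $X$. $X\in\operatorname{mod}A$ is $\tau$-rigid if $\operatorname{Hom}_A(X,\tau X)=0$; it is $\tau$-tilting if it is $\tau$-rigid and $|X|=|A|$; it is support $\tau$-tilting if there is an idempotent $e\in A$ such that $X$ is a $\tau$-tilting $A/\langle e\rangle$-module, where $\langle e\rangle$ is the two-sided ideal generated by $e$. A morphism $f:D\to T$ with $T$ in a full subcategory $\mathcal{T}$ is a left $\mathcal{T}$-approximation of $D$ if every morphism $D\to T'$ with $T'\in\mathcal{T}$ factors through $f$; it is minimal if every endomorphism $h$ of $T$ with $hf=f$ is an automorphism. Modules over the triangular matrix algebra: a right $A$-module is identified with a triple $(X,Y)_f$ (or $(X,Y)$ if $f$ is clear), where $X$ is a right $B$-module, $Y$ is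 a right $C$-module and $f:Y\otimes_C M\to X$ is a right $B$-module map. A morphism $(X,Y)_f\to(X',Y')_{f'}$ is a pair $(\alpha,\beta)$ with $\alpha\in\operatorname{Hom}_B(X,X')$, $\beta\in\operatorname{Hom}_C(Y,Y')$ and $\alpha f=f'(\beta\otimes \mathrm{id}_M)$. *)

(* Defs.v *)
From HB Require Import structures.
From mathcomp Require Import all_boot all_algebra.

Set Implicit Arguments.
Unset Strict Implicit.
Unset Printing Implicit Defensive.

Import GRing.Theory.
Local Open Scope ring_scope.

(* MathComp's algType and falgType require 1 != 0.  The zero algebra is needed
   here, since it occurs as A/<e> when <e> = A. *)
HB.mixin Record Vector_isFinDimAlg (k : fieldType) A of Vector k A := {
  fdone : A;
  fdmul : A -> A -> A;
  fdmulA : associative fdmul;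
  fdmul1 : left_id fdone fdmul;
  fdmulr1 : right_id fdone fdmul;
  fdmul_linl : forall b, linear (fdmul^~ b);
  fdmul_linr : forall a, linear (fdmul a)
}.
#[short(type="fdAlgType")]
HB.structure Definition FinDimAlg (k : fieldType) :=
  {A of Vector k A & Vector_isFinDimAlg k A}.
Section FinDimAlgRing.
Variables (k : fieldType) (A : fdAlgType k).
Fact fdmulDl : left_distributive (@fdmul k A) +%R.
Proof. by move=> x y z; have := fdmul_linl z 1 x y; rewrite !scale1r. Qed.
Fact fdmulDr : right_distributive (@fdmul k A) +%R.
Proof. by move=> x y z; have := fdmul_linr x 1 y z; rewrite !scale1r. Qed.
HB.instance Definition _ := GRing.Zmodule_isPzRing.Build A
  (@fdmulA k A) (@fdmul1 k A) (@fdmulr1 k A) fdmulDl fdmulDr.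
Lemma fdscaleAl (l : k) (u v : A) : l *: (u * v) = (l *: u) * v.
Proof.
by have := fdmul_linl v l u 0; rewrite addr0 -![fdmul _ _]/(_ * _) mul0r addr0.
Qed.
Lemma fdscaleAr (l : k) (u v : A) : l *: (u * v) = u * (l *: v).
Proof.
by have := fdmul_linr u l v 0; rewrite addr0 -![fdmul _ _]/(_ * _) mulr0 addr0.
Qed.
End FinDimAlgRing.

Record rightMod (k : fieldType) (A : fdAlgType k) := RightMod {
  rm_vect :> vectType k;
  ract : rm_vect -> A -> rm_vect;
  ract_linl : forall a, linear (fun x => ract x a);
  ract_linr : forall x, linear (ract x);
  ract1 : forall x, ract x 1 = x;
  ractM : forall x a b, ract x (a * b) = ract (ract x a) b
}.

Record leftMod (k : fieldType) (A : fdAlgType k) := LeftMod {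
  lm_vect :> vectType k;
  lact : A -> lm_vect -> lm_vect;
  lact_linl : forall x, linear (fun a => lact a x);
  lact_linr : forall a, linear (lact a);
  lact1 : forall x, lact 1 x = x;
  lactM : forall a b x, lact (a * b) x = lact a (lact b x)
}.

Record bimod (k : fieldType) (C B : fdAlgType k) := Bimod {
  bm_right :> rightMod B;
  blact : C -> bm_right -> bm_right;
  blact_linl : forall m, linear (fun c => blact c m);
  blact_linr : forall c, linear (blact c);
  blact1 : forall m, blact 1 m = m;
  blactM : forall c d m, blact (c * d) m = blact c (blact d m);
  blactA : forall c m b, blact c (ract m b) = ract (blact c m) b
}.

Record rhom (k : fieldType) (A : fdAlgType k) (X Y : rightMod A) := RHom {
  rhom_lfun :> 'Hom(X, Y);
  rhomP : forall x a, rhom_lfun (ract x a) = ract (rhom_lfun x) a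
}.

Section LinearActions.
Variables (k : fieldType) (A : fdAlgType k).

Section Right.
Variable X : rightMod A.
Definition ractr (a : A) (x : X) := ract x a.
HB.instance Definition _ a :=
  GRing.isLinear.Build k X X _ (ractr a) (@ract_linl _ _ X a).
HB.instance Definition _ x :=
  GRing.isLinear.Build k A X _ (@ract _ _ X x) (@ract_linr _ _ X x).
Lemma ractDl (a : A) (x y : X) : ract (x + y) a = ract x a + ract y a.
Proof. exact: (linearD (ractr a)). Qed.
Lemma ractBl (a : A) (x y : X) : ract (x - y) a = ract x a - ract y a.
Proof. exact: (linearB (ractr a)). Qed.
Lemma ractZl (a : A) l (x : X) : ract (l *: x) a = l *: ract x a.
Proof. exact: (linearZZ (ractr a)). Qed.
Lemma ract0l (a : A) : ract (0 : X) a = 0.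
Proof. exact: (linear0 (ractr a)). Qed.
Lemma ract_suml (a : A) I (r : seq I) (F : I -> X) :
  ract (\sum_(i <- r) F i) a = \sum_(i <- r) ract (F i) a.
Proof. exact: (linear_sum (ractr a)). Qed.
Lemma ractDr (x : X) (a b : A) : ract x (a + b) = ract x a + ract x b.
Proof. exact: linearD. Qed.
Lemma ractBr (x : X) (a b : A) : ract x (a - b) = ract x a - ract x b.
Proof. exact: linearB. Qed.
Lemma ractZr (x : X) l (a : A) : ract x (l *: a) = l *: ract x a.
Proof. exact: linearZZ. Qed.
End Right.

Section Left.
Variable L : leftMod A.
Lemma lactDl (x : L) (a b : A) : lact (a + b) x = lact a x + lact b x.
Proof. by have := lact_linl x 1 a b; rewrite !scale1r. Qed.
Lemma lactDr (a : A) (x y : L) : lact a (x + y) = lact a x + lact a y.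
Proof. by have := lact_linr a 1 x y; rewrite !scale1r. Qed.
Lemma lact0r (a : A) : lact a (0 : L) = 0.
Proof. by apply: (addIr (lact a 0)); rewrite -lactDr !add0r. Qed.
Lemma lactZr (a : A) l (x : L) : lact a (l *: x) = l *: lact a x.
Proof. by have := lact_linr a l x 0; rewrite !addr0 lact0r addr0. Qed.
End Left.
End LinearActions.

Section Modules.
Variables (k : fieldType) (A : fdAlgType k).
Implicit Types X Y Z P U V T D : rightMod A.

Fact zero_hom_subproof X Y (x : X) (a : A) :
  (0 : 'Hom(X, Y)) (ract x a) = ract ((0 : 'Hom(X, Y)) x) a.
Proof. by rewrite !zero_lfunE ract0l. Qed.
Definition zero_hom X Y : rhom X Y := RHom (@zero_hom_subproof X Y).

Definition zero_mod : rightMod A.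
Proof.
refine (@RightMod k A _ (fun (x : 'rV[k]_0) _ => x) _ _ _ _) => //.
by move=> x l a b; rewrite [RHS]thinmx0 [LHS]thinmx0.
Defined.

Definition reg_mod : rightMod A.
Proof.
refine (@RightMod k A _ (fun x a : A => x * a) _ _ _ _).
- by move=> a l x y; rewrite mulrDl fdscaleAl.
- by move=> x l a b; rewrite mulrDr fdscaleAr.
- exact: mulr1.
- exact: mulrA.
Defined.

Definition sum_mod X Y : rightMod A.
Proof.
refine (@RightMod k A _ (fun (p : X * Y) a => (ract p.1 a, ract p.2 a)) _ _ _ _).
- by move=> a l x y; rewrite /= !ractDl !ractZl.
- by move=> x l a b; rewrite /= !ractDr !ractZr.
- by case=> x y; rewrite !ract1.
- by move=> x a b; rewrite !ractM.
Defined.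

Definition pow_mod X (n : nat) : rightMod A.
Proof.
refine (@RightMod k A _ (fun (x : {ffun 'I_n -> X}) a => [ffun i => ract (x i) a]) _ _ _ _).
- by move=> a l x y; apply/ffunP=> i; rewrite !ffunE ractDl ractZl.
- by move=> x l a b; apply/ffunP=> i; rewrite !ffunE ractDr ractZr.
- by move=> x; apply/ffunP=> i; rewrite !ffunE ract1.
- by move=> x a b; apply/ffunP=> i; rewrite !ffunE ractM.
Defined.

Definition surjective_hom X Y (f : rhom X Y) := limg f = fullv.

Definition iso_mod X Y := exists f : rhom X Y, bijective f.

Definition is_zero_mod X := forall x : X, x = 0.

Definition indecomposable X :=
  ~ is_zero_mod X /\
  forall U V, iso_mod X (sum_mod U V) -> is_zero_mod U \/ is_zero_mod V.

Definition direct_summand U X := exists V, iso_mod X (sum_mod U V).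

(* num_indec X n means |X| = n. *)
Definition num_indec X (n : nat) :=
  exists S : 'I_n -> rightMod A,
    [/\ forall i, indecomposable (S i) /\ direct_summand (S i) X,
        forall i j, iso_mod (S i) (S j) -> i = j
      & forall U, indecomposable U -> direct_summand U X ->
          exists i, iso_mod U (S i)].

Definition Fac X : rightMod A -> Prop :=
  fun U => exists n, exists f : rhom (pow_mod X n) U, surjective_hom f.

Definition left_approx (TT : rightMod A -> Prop) D T (f : rhom D T) :=
  TT T /\
  forall T', TT T' -> forall g : rhom D T',
    exists h : rhom T T', forall x, h (f x) = g x.

Definition min_left_approx (TT : rightMod A -> Prop) D T (f : rhom D T) :=
  left_approx TT f /\
  forall h : rhom T T, (forall x, h (f x) = f x) -> bijective h.

Definition projective P :=
  forall X Y (g : rhom X Y), surjective_hom g ->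
  forall f : rhom P Y, exists h : rhom P X, forall x, g (h x) = f x.

Definition is_submod X (N : {vspace X}) :=
  forall x a, x \in N -> ract x a \in N.

Definition superfluous X (N : {vspace X}) :=
  forall N' : {vspace X}, is_submod N' ->
    (N + N')%VS = fullv -> N' = fullv.

(* P1 -> P0 -> X -> 0 is exact, and P0 -> X and P1 -> ker p0 are projective
   covers. *)
Definition min_proj_pres X P1 P0 (p1 : rhom P1 P0) (p0 : rhom P0 X) :=
  [/\ projective P1, projective P0,
      surjective_hom p0 /\ limg p1 = lker p0,
      superfluous (lker p0) & superfluous (lker p1)].

Definition homv X Y : {vspace 'Hom(X, Y)} :=
  (\bigcap_(i < \dim {:A})
     lker (linfun (fun f : 'Hom(X, Y) =>
       (f \o linfun (ractr (X := X) (vbasis {:A})`_i))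
       - (linfun (ractr (X := Y) (vbasis {:A})`_i) \o f))%VF))%VS.

Lemma homvP X Y (f : 'Hom(X, Y)) :
  reflect (forall x a, f (ract x a) = ract (f x) a) (f \in homv X Y).
Proof.
pose G a (f : 'Hom(X, Y)) :=
  ((f \o linfun (ractr (X := X) a))
       - (linfun (ractr (X := Y) a) \o f))%VF.
have linG a : linear (G a).
  move=> l u v; rewrite /G comp_lfunDl comp_lfunDr -comp_lfunZl -comp_lfunZr.
  by rewrite scalerBr opprD addrACA.
have GE a (g : 'Hom(X, Y)) : linfun (G a) g = G a g.
  pose L := GRing.isLinear.Build _ _ _ _ (G a) (linG a).
  pose GL : {linear _ -> _} := HB.pack (G a) L.
  exact: (lfunE GL).
have mE a x (g : 'Hom(X, Y)) : G a g x = g (ract x a) - ract (g x) a.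
  by rewrite add_lfunE opp_lfunE !comp_lfunE !lfunE.
have memE : (f \in homv X Y) =
    [forall i : 'I_(\dim {:A}), G (vbasis {:A})`_i f == 0].
  rewrite memvE /homv; apply/subv_bigcapP/forallP => H i.
    by have := H i isT; rewrite -memvE memv_ker GE.
  by move=> _; rewrite -memvE memv_ker GE.
rewrite memE; apply: (iffP forallP) => [H x a | H i].
  have Hi (i : 'I_(\dim {:A})) :
      f (ract x (vbasis {:A})`_i) = ract (f x) (vbasis {:A})`_i.
    by apply/eqP; rewrite -subr_eq0 -mE (eqP (H i)) zero_lfunE.
  rewrite (coord_vbasis (memvf a)) !linear_sum /=; apply: eq_bigr => i _.
  by rewrite !linearZ /= Hi.
by apply/eqP/lfunP => x; rewrite mE H subrr zero_lfunE.
Qed.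

Definition lmul (a : A) : 'Hom(A, A) := linfun (fun y : A => a * y).

Lemma lmulE (a y : A) : lmul a y = a * y.
Proof.
have L : linear (fun y : A => a * y).
  by move=> l u v; rewrite mulrDr fdscaleAr.
pose M := GRing.isLinear.Build _ _ _ _ (fun y : A => a * y) L.
pose F : {linear _ -> _} := HB.pack (fun y : A => a * y) M.
exact: (lfunE F).
Qed.

Fact star_subproof P (a : A) (g : subvs_of (homv P reg_mod)) :
  (lmul a \o val g)%VF \in homv P reg_mod.
Proof.
apply/homvP=> x b; rewrite !comp_lfunE !lmulE.
by have /homvP -> := valP g; rewrite /= mulrA.
Qed.

(* The left A-module Hom_A(P, A), with (a g)(x) = a * g x. *)
Definition star_mod P : leftMod A.
Proof.
refine (@LeftMod k A _ (fun a (g : subvs_of (homv P reg_mod)) =>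
  Subvs (star_subproof a g) : subvs_of (homv P reg_mod)) _ _ _ _).
- move=> g l a b; apply/val_inj/lfunP=> x /=.
  rewrite add_lfunE scale_lfunE !comp_lfunE !lmulE.
  by rewrite mulrDl -fdscaleAl.
- move=> a l g h; apply/val_inj/lfunP=> x /=.
  rewrite add_lfunE scale_lfunE !comp_lfunE !lmulE add_lfunE scale_lfunE.
  by rewrite mulrDr -fdscaleAr.
- by move=> g; apply/val_inj/lfunP=> x /=; rewrite comp_lfunE lmulE mul1r.
- move=> a b g; apply/val_inj/lfunP=> x /=.
  by rewrite !comp_lfunE !lmulE mulrA.
Defined.

Fact star_hom_subproof P Q (p : rhom P Q) (g : star_mod Q) :
  (val g \o p)%VF \in homv P reg_mod.
Proof.
apply/homvP=> x a; rewrite !comp_lfunE rhomP.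
by have /homvP -> := valP g.
Qed.

(* p^* : Hom_A(Q, A) -> Hom_A(P, A), g |-> g o p. *)
Definition star_hom P Q (p : rhom P Q) : 'Hom(star_mod Q, star_mod P) :=
  linfun (fun g : star_mod Q => Subvs (star_hom_subproof p g) : star_mod P).

Lemma star_homE P Q (p : rhom P Q) (g : star_mod Q) :
  val (star_hom p g) = (val g \o p)%VF.
Proof.
pose F (g : star_mod Q) := Subvs (star_hom_subproof p g) : star_mod P.
have L : linear F.
  move=> l u v; apply/val_inj/lfunP=> x /=.
  by rewrite add_lfunE scale_lfunE !comp_lfunE add_lfunE scale_lfunE.
pose FM := GRing.isLinear.Build _ _ _ _ F L.
pose FL : {linear _ -> _} := HB.pack F FM.
by rewrite /star_hom (lfunE FL).
Qed.

(* L = Tr X, the cokernel of p1^* for a minimal projective presentation of X: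
   P0^* -> P1^* -> L -> 0 is an exact sequence of left A-modules. *)
Definition is_transpose X (L : leftMod A) :=
  exists P1 P0 (p1 : rhom P1 P0) (p0 : rhom P0 X),
    min_proj_pres p1 p0 /\
    exists q : 'Hom(star_mod P1, L),
      [/\ forall a g, q (lact a g) = lact a (q g),
          limg q = fullv & lker q = limg (star_hom p1)].

Definition lactf (L : leftMod A) (a : A) : 'Hom(L, L) := linfun (lact a).

Lemma lactfE (L : leftMod A) (a : A) (x : L) : lactf L a x = lact a x.
Proof.
pose M := GRing.isLinear.Build _ _ _ _ (@lact _ _ L a) (@lact_linr _ _ L a).
pose F : {linear _ -> _} := HB.pack (@lact _ _ L a) M.
exact: (lfunE F).
Qed.

(* The k-dual D L = Hom_k(L, k), with (phi a)(x) = phi (a x). *)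
Definition dual_mod (L : leftMod A) : rightMod A.
Proof.
refine (@RightMod k A _ (fun (phi : 'Hom(L, k^o)) a => (phi \o lactf L a)%VF) _ _ _ _).
- by move=> a l u v /=; rewrite comp_lfunDl -comp_lfunZl.
- move=> phi l a b; apply/lfunP=> x.
  rewrite add_lfunE scale_lfunE !comp_lfunE !lactfE.
  by rewrite (lact_linl x l a b) linearP.
- by move=> phi; apply/lfunP=> x; rewrite comp_lfunE lactfE lact1.
- by move=> phi a b; apply/lfunP=> x; rewrite !comp_lfunE !lactfE lactM.
Defined.

(* The Auslander-Reiten translate is D Tr X; Tr X, hence tau X, is only
   defined up to isomorphism. *)
Definition is_AR_translate X T :=
  exists L : leftMod A, is_transpose X L /\ T = dual_mod L.

Definition tau_rigid X :=
  exists T, is_AR_translate X T /\ forall h : rhom X T, h = 0 :> 'Hom(X, T).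

Definition tau_tilting X :=
  tau_rigid X /\ exists n, num_indec X n /\ num_indec reg_mod n.

End Modules.

(* V/U is carried by the complement U^C; quotv_pi is the projection of V onto
   U^C along U. *)
Section QuotientSpace.
Variables (k : fieldType) (V : vectType k) (U : {vspace V}).

Definition quotv := subvs_of (U^C)%VS.
HB.instance Definition _ := Vector.on quotv.

Definition quotv_pi : 'Hom(V, quotv) :=
  (linfun (vsproj (U^C)%VS) \o daddv_pi (U^C)%VS U)%VF.

Lemma quotv_val_pi v : vsval (quotv_pi v) = daddv_pi (U^C)%VS U v.
Proof. by rewrite comp_lfunE lfunE /= vsprojK // memv_pi. Qed.

Lemma quotv_capC : (U^C :&: U)%VS = 0%VS.
Proof. by rewrite capvC capv_compl. Qed.

Lemma quotv_piK (q : quotv) : quotv_pi (vsval q) = q.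
Proof.
apply: val_inj; rewrite /= quotv_val_pi daddv_pi_id ?quotv_capC //.
exact: subvsP.
Qed.

Lemma quotv_pi_sub v : v - vsval (quotv_pi v) \in U.
Proof.
have : v \in (U^C + U)%VS by rewrite addvC addv_complf memvf.
move/(daddv_pi_add quotv_capC) => {1}<-.
by rewrite quotv_val_pi addrC addKr memv_pi.
Qed.

Lemma quotv_pi_eq0 v : (quotv_pi v == 0) = (v \in U).
Proof.
apply/eqP/idP => [v0 | vU].
  by have := quotv_pi_sub v; rewrite v0 -[vsval 0]/(0 : V) subr0.
apply: val_inj; apply/eqP; rewrite -[val 0]/(0 : V) -memv0 -quotv_capC.
rewrite memv_cap subvsP /=.
have -> : vsval (quotv_pi v) = v - (v - vsval (quotv_pi v)).
  by rewrite opprB addrCA subrr addr0.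
by rewrite memvB // quotv_pi_sub.
Qed.

Lemma quotv_pi_eq u v : (quotv_pi u == quotv_pi v) = (u - v \in U).
Proof. by rewrite -subr_eq0 -linearB quotv_pi_eq0. Qed.
End QuotientSpace.

Section QuotientAlgebra.
Variables (k : fieldType) (A : fdAlgType k) (e : A).

(* <e> = A e A is spanned by the a * e * b with a, b in a basis of A. *)
Definition ideal : {vspace A} :=
  <<[seq a * e * b | a <- vbasis {:A}, b <- vbasis {:A}]>>%VS.

Lemma mem_ideal (a b : A) : a * e * b \in ideal.
Proof.
rewrite (coord_vbasis (memvf a)) (coord_vbasis (memvf b)) !mulr_suml.
apply: memv_suml => i _; rewrite mulr_sumr; apply: memv_suml => j _.
rewrite -fdscaleAr -!fdscaleAl !memvZ //; apply: memv_span.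
by apply: allpairs_f; apply: mem_nth; rewrite size_tuple.
Qed.

Lemma ideal_gen : e \in ideal.
Proof. by have := mem_ideal 1 1; rewrite mul1r mulr1. Qed.

Lemma ideal_min (U : {vspace A}) : e \in U ->
  (forall a x, x \in U -> a * x \in U) ->
  (forall x a, x \in U -> x * a \in U) -> (ideal <= U)%VS.
Proof.
move=> eU Ul Ur; apply/span_subvP => _ /allpairsP[p [_ _ ->]].
exact/Ur/Ul.
Qed.

Lemma ideal_mull (a x : A) : x \in ideal -> a * x \in ideal.
Proof.
move=> xI; rewrite -lmulE.
suff: (ideal <= lmul a @^-1: ideal)%VS by move/subvP/(_ _ xI); rewrite memv_preim.
apply/span_subvP => _ /allpairsP[p [_ _ ->]].
by rewrite -memv_preim lmulE !mulrA mem_ideal.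
Qed.

Lemma ideal_mulr (x a : A) : x \in ideal -> x * a \in ideal.
Proof.
move=> xI; pose F := linfun (ractr (X := reg_mod A) a).
have FE (y : A) : F y = y * a by rewrite lfunE.
rewrite -FE.
suff: (ideal <= F @^-1: ideal)%VS by move/subvP/(_ _ xI); rewrite memv_preim.
apply/span_subvP => _ /allpairsP[p [_ _ ->]].
by rewrite -memv_preim FE -mulrA mem_ideal.
Qed.

Definition quotAlg := quotv ideal.
HB.instance Definition _ := Vector.on quotAlg.

Definition quotAlg_pi : 'Hom(A, quotAlg) := quotv_pi ideal.
Definition quot_one : quotAlg := quotAlg_pi 1.
Definition quot_mul (x y : quotAlg) : quotAlg := quotAlg_pi (vsval x * vsval y).

Fact quot_mul_pi x y : quot_mul (quotAlg_pi x) (quotAlg_pi y) = quotAlg_pi (x * y).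
Proof.
apply/eqP; rewrite quotv_pi_eq -opprB memvN.
have -> : x * y - vsval (quotAlg_pi x) * vsval (quotAlg_pi y) =
    (x - vsval (quotAlg_pi x)) * y + vsval (quotAlg_pi x) * (y - vsval (quotAlg_pi y)).
  by rewrite mulrBl mulrBr addrA subrK.
by apply: memvD; [apply: ideal_mulr | apply: ideal_mull]; apply: quotv_pi_sub.
Qed.

Fact quotAlg_piK (q : quotAlg) : quotAlg_pi (vsval q) = q. Proof. exact: quotv_piK. Qed.

Fact quot_mulA : associative quot_mul.
Proof.
move=> x y z; rewrite -(quotAlg_piK x) -(quotAlg_piK y) -(quotAlg_piK z) !quot_mul_pi.
by rewrite mulrA.
Qed.
Fact quot_mul1 : left_id quot_one quot_mul.
Proof. by move=> x; rewrite -(quotAlg_piK x) quot_mul_pi mul1r. Qed.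
Fact quot_mulr1 : right_id quot_one quot_mul.
Proof. by move=> x; rewrite -(quotAlg_piK x) quot_mul_pi mulr1. Qed.
Fact quot_mulDl : left_distributive quot_mul +%R.
Proof.
move=> x y z; rewrite -(quotAlg_piK x) -(quotAlg_piK y) -(quotAlg_piK z) -linearD !quot_mul_pi.
by rewrite mulrDl linearD.
Qed.
Fact quot_mulDr : right_distributive quot_mul +%R.
Proof.
move=> x y z; rewrite -(quotAlg_piK x) -(quotAlg_piK y) -(quotAlg_piK z) -linearD !quot_mul_pi.
by rewrite mulrDr linearD.
Qed.

Fact quot_mul_linl (y : quotAlg) : linear (quot_mul^~ y).
Proof.
move=> l u v; rewrite quot_mulDl; congr (_ + _).
rewrite -(quotAlg_piK u) -(quotAlg_piK y) -linearZ !quot_mul_pi /=.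
by rewrite -fdscaleAl linearZ.
Qed.
Fact quot_mul_linr (x : quotAlg) : linear (quot_mul x).
Proof.
move=> l u v; rewrite quot_mulDr; congr (_ + _).
rewrite -(quotAlg_piK u) -(quotAlg_piK x) -linearZ !quot_mul_pi /=.
by rewrite -fdscaleAr linearZ.
Qed.
HB.instance Definition _ := Vector_isFinDimAlg.Build k quotAlg
  quot_mulA quot_mul1 quot_mulr1 quot_mul_linl quot_mul_linr.
HB.instance Definition _ := GRing.PzRing.copy quotAlg (quotAlg : fdAlgType k).

Lemma quotAlg_piM a b : quotAlg_pi (a * b) = quotAlg_pi a * quotAlg_pi b.
Proof. by rewrite -[RHS]/(quot_mul (quotAlg_pi a) (quotAlg_pi b)) quot_mul_pi. Qed.

Lemma quotAlg_pi1 : quotAlg_pi 1 = 1. Proof. by []. Qed.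

Definition annihilates (X : rightMod A) :=
  forall (x : X) a, a \in ideal -> ract x a = 0.

Lemma annihilates_pi (X : rightMod A) (XI : annihilates X) (x : X) a :
  ract x (vsval (quotAlg_pi a)) = ract x a.
Proof.
by apply/esym/eqP; rewrite -subr_eq0 -ractBr XI // quotv_pi_sub.
Qed.

(* An A-module killed by <e>, viewed as an A/<e>-module. *)
Definition descend (X : rightMod A) (XI : annihilates X) : rightMod quotAlg.
Proof.
refine (@RightMod k quotAlg X (fun x q => ract x (vsval q)) _ _ _ _).
- by move=> q; exact: ract_linl.
- by move=> x l q r; rewrite !linearP.
- by move=> x; rewrite -quotAlg_pi1 (annihilates_pi XI) ract1.
- by move=> x q r; rewrite (annihilates_pi XI) ractM.
Defined.
End QuotientAlgebra.

Definition support_tau_tilting (k : fieldType) (A : fdAlgType k)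
    (X : rightMod A) :=
  exists (e : A) (XI : annihilates e X),
    e * e = e /\ tau_tilting (descend XI).

Section QuotientModule.
Variables (k : fieldType) (A : fdAlgType k) (X : rightMod A).
Variables (N : {vspace X}) (NP : is_submod N).

Lemma quot_ract (x : X) a :
  quotv_pi N (ract (vsval (quotv_pi N x)) a) = quotv_pi N (ract x a).
Proof.
apply/eqP; rewrite quotv_pi_eq -ractBl NP //.
by rewrite -opprB memvN quotv_pi_sub.
Qed.

Definition quot_mod : rightMod A.
Proof.
refine (@RightMod k A _ (fun (q : quotv N) a => quotv_pi N (ract (vsval q) a)) _ _ _ _).
- move=> a l q r; rewrite -[vsval _]/(l *: vsval q + vsval r).
  by rewrite ractDl ractZl linearP.
- by move=> q l a b; rewrite !linearP.
- by move=> q; rewrite ract1 quotv_piK.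
- by move=> q a b; rewrite quot_ract ractM.
Defined.
End QuotientModule.

Lemma linear_coord (k : fieldType) (V W : vectType k) (F : V -> W) :
  linear F -> forall v,
  F v = \sum_(i < \dim {:V}) coord (vbasis {:V}) i v *: F (vbasis {:V})`_i.
Proof.
move=> L v; pose FM := GRing.isLinear.Build _ _ _ _ F L.
pose FL : {linear _ -> _} := HB.pack F FM.
rewrite -[F]/(FL : V -> W) [in LHS](coord_vbasis (memvf v)) linear_sum.
by apply: eq_bigr => i _; rewrite linearZ.
Qed.

(* Y (x)_k M is carried by the matrices over bases of Y and M; Y (x)_C M is its
   quotient by the span of the (y c) (x) m - y (x) (c m). *)
Section Tensor.
Variables (k : fieldType) (C B : fdAlgType k) (Y : rightMod C) (M : bimod C B).

Definition ktens0 (y : Y) (m : M) : 'M[k]_(\dim {:Y}, \dim {:M}) :=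
  \matrix_(i, j) (coord (vbasis {:Y}) i y * coord (vbasis {:M}) j m).

Definition ract_mx (b : B) : 'M[k]_(\dim {:M}) :=
  \matrix_(i, j) coord (vbasis {:M}) j (ract (vbasis {:M})`_i b).

Lemma ktens0_ract y m b : ktens0 y m *m ract_mx b = ktens0 y (ract m b).
Proof.
apply/matrixP=> i j; rewrite !mxE.
under eq_bigr do rewrite !mxE -mulrA.
rewrite -mulr_sumr; congr (_ * _).
rewrite {2}(coord_vbasis (memvf m)) ract_suml linear_sum.
by apply: eq_bigr => l _; rewrite ractZl linearZ.
Qed.

Lemma ktens0_linl m : linear (fun y => ktens0 y m).
Proof.
by move=> l x y; apply/matrixP=> i j; rewrite !mxE linearP mulrDl /= mulrA.
Qed.
Lemma ktens0_linr y : linear (ktens0 y).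
Proof.
move=> l m n; apply/matrixP=> i j; rewrite !mxE linearP mulrDr /=.
by rewrite !mulrA [_ * l]mulrC.
Qed.

Lemma ract_mx_lin : linear ract_mx.
Proof. by move=> l a b; apply/matrixP=> i j; rewrite !mxE !linearP. Qed.

Lemma ract_mx1 : ract_mx 1 = 1%:M.
Proof.
apply/matrixP=> i j; rewrite !mxE ract1 coord_free ?(eq_sym j) //.
exact: basis_free (vbasisP _).
Qed.

Lemma ract_mxM a b : ract_mx (a * b) = ract_mx a *m ract_mx b.
Proof.
apply/matrixP=> i j; rewrite !mxE ractM.
under eq_bigr do rewrite !mxE.
rewrite [in LHS](coord_vbasis (memvf (ract _ a))).
rewrite ract_suml linear_sum.
by apply: eq_bigr => l _; rewrite ractZl linearZ.
Qed.

Definition ktens_mod : rightMod B.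
Proof.
refine (@RightMod k B _ (fun (t : 'M[k]_(\dim {:Y}, \dim {:M})) b => t *m ract_mx b) _ _ _ _).
- by move=> b l s t; rewrite mulmxDl -scalemxAl.
- by move=> t l a b; rewrite ract_mx_lin mulmxDr -scalemxAr.
- by move=> t; rewrite ract_mx1 mulmx1.
- by move=> t a b; rewrite ract_mxM mulmxA.
Defined.

Definition ktens (y : Y) (m : M) : ktens_mod := ktens0 y m.

Definition tens_rel : {vspace ktens_mod} :=
  <<[seq ktens (ract p.1 c) p.2 - ktens p.1 (blact c p.2)
      | p <- [seq (y, m) | y <- vbasis {:Y}, m <- vbasis {:M}],
        c <- vbasis {:C}]>>%VS.

Lemma mem_tens_rel y m c :
  ktens (ract y c) m - ktens y (blact c m) \in tens_rel.
Proof.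
rewrite (linear_coord (F := fun y => ktens (ract y c) m - ktens y (blact c m))); last first.
  move=> l u v; rewrite ractDl ractZl /ktens !ktens0_linl.
  by rewrite scalerBr opprD addrACA.
apply: memv_suml => i _; apply: memvZ; set y' := _`_i.
rewrite (linear_coord (F := fun m => ktens (ract y' c) m - ktens y' (blact c m))); last first.
  move=> l u v; rewrite blact_linr /ktens !ktens0_linr.
  by rewrite scalerBr opprD addrACA.
apply: memv_suml => j _; apply: memvZ; set m' := _`_j.
rewrite (linear_coord (F := fun c => ktens (ract y' c) m' - ktens y' (blact c m'))); last first.
  move=> l u v; rewrite blact_linl ractDr ractZr /ktens ktens0_linr ktens0_linl.
  by rewrite scalerBr opprD addrACA.
apply: memv_suml => h _; apply: memvZ; apply: memv_span.
have mb (V : vectType k) (s : 'I_(\dim {:V})) : (vbasis {:V})`_s \in vbasis {:V}.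
  by rewrite mem_nth // size_tuple.
apply: (allpairs_f (fun p c => ktens (ract p.1 c) p.2 - ktens p.1 (blact c p.2))
  (x := (y', m'))); last exact: mb.
by apply: allpairs_f; exact: mb.
Qed.

Fact tens_rel_submod : is_submod tens_rel.
Proof.
move=> t b tR; pose F := linfun (ractr (X := ktens_mod) b).
have FE t' : F t' = ract t' b by rewrite lfunE.
rewrite -FE.
suff: (tens_rel <= F @^-1: tens_rel)%VS by move/subvP/(_ _ tR); rewrite memv_preim.
apply/span_subvP => _ /allpairsP[[p c] [_ _ ->]] /=.
rewrite -memv_preim FE ractBl.
by rewrite /= /ktens !ktens0_ract -blactA mem_tens_rel.
Qed.

Definition tensor_mod : rightMod B := quot_mod tens_rel_submod.

Definition tensor (y : Y) (m : M) : tensor_mod := quotv_pi tens_rel (ktens y m).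

Lemma tensor_linl m : linear (fun y => tensor y m).
Proof. by move=> l x y; rewrite /tensor /ktens ktens0_linl linearP. Qed.

Lemma tensor_linr y : linear (tensor y).
Proof. by move=> l m n; rewrite /tensor /ktens ktens0_linr linearP. Qed.

Lemma tensor_balanced y c m : tensor (ract y c) m = tensor y (blact c m).
Proof. by apply/eqP; rewrite quotv_pi_eq mem_tens_rel. Qed.

Lemma tensor_ract y m b : ract (tensor y m) b = tensor y (ract m b).
Proof.
by rewrite /= (quot_ract tens_rel_submod) /= /tensor /ktens ktens0_ract.
Qed.

Lemma ktens_sum (t : ktens_mod) :
  t = \sum_i \sum_j (t : 'M__) i j *:
        ktens (vbasis {:Y})`_i (vbasis {:M})`_j.
Proof.
rewrite {1}[t](matrix_sum_delta (t : 'M__)).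
apply: eq_bigr => i _; apply: eq_bigr => j _; congr (_ *: _).
apply/matrixP=> i' j'; rewrite !mxE.
rewrite !coord_free ?(basis_free (vbasisP _)) // -natrM mulnb.
by rewrite (eq_sym i) (eq_sym j).
Qed.

Lemma tensor_universal (V : vectType k) (g : Y -> M -> V) :
  (forall m, linear (fun y => g y m)) -> (forall y, linear (g y)) ->
  (forall y c m, g (ract y c) m = g y (blact c m)) ->
  exists! h : 'Hom(tensor_mod, V), forall y m, h (tensor y m) = g y m.
Proof.
move=> gl gr gb.
pose G (t : ktens_mod) : V := \sum_i \sum_j (t : 'M__) i j *:
        g (vbasis {:Y})`_i (vbasis {:M})`_j.
have GL : linear G.
  move=> l s t; rewrite /G scaler_sumr -big_split /=; apply: eq_bigr => i _.
  rewrite scaler_sumr -big_split /=; apply: eq_bigr => j _.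
  by rewrite !mxE scalerA -scalerDl.
pose GM := GRing.isLinear.Build _ _ _ _ G GL.
pose GF : {linear _ -> _} := HB.pack G GM.
have GE t : linfun G t = G t by exact: (lfunE GF).
have Gt y m : G (ktens y m) = g y m.
  rewrite (linear_coord (gl m)); apply: eq_bigr => i _.
  rewrite [g _ m](linear_coord (gr _)) scaler_sumr.
  by apply: eq_bigr => j _; rewrite mxE scalerA.
have Gsub s t : G (s - t) = G s - G t.
  by rewrite -!GE; exact: linearB.
have Grel (t : ktens_mod) : t \in tens_rel -> G t = 0.
  move=> tR; rewrite -GE; apply/eqP; rewrite -memv_ker.
  apply: (subvP _ _ tR); apply/span_subvP => _ /allpairsP[[p c] [_ _ ->]] /=.
  rewrite memv_ker; apply/eqP/(etrans (GE _))/(etrans (Gsub _ _)).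
  by rewrite !Gt gb subrr.
have Gpi (t : ktens_mod) : G (vsval (quotv_pi tens_rel t)) = G t.
  apply/eqP; rewrite eq_sym -subr_eq0 -Gsub Grel //.
  exact: quotv_pi_sub.
pose H (q : tensor_mod) : V := G (vsval q).
have HL : linear H by move=> l s t; rewrite /H -GL.
pose HM := GRing.isLinear.Build _ _ _ _ H HL.
pose HF : {linear _ -> _} := HB.pack H HM.
exists (linfun HF); split.
  by move=> y m; rewrite (lfunE HF) -[LHS]/(H _) /H Gpi Gt.
move=> h hE; apply/lfunP => q; rewrite (lfunE HF) -[LHS]/(G (vsval q)).
rewrite -[q in RHS]quotv_piK [X in quotv_pi _ X]ktens_sum !linear_sum.
apply: eq_bigr => i _; rewrite !linear_sum; apply: eq_bigr => j _.
by rewrite 2!linearZ /= -hE.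
Qed.
End Tensor.

Section Triangular.
Variables (k : fieldType) (B C : fdAlgType k) (M : bimod C B).

(* The matrix [b 0; m c] is encoded as (b, m, c). *)
Definition triAlg := (B * M * C)%type.
HB.instance Definition _ := Vector.on triAlg.

Definition tri_one : triAlg := (1, 0, 1).
Definition tri_mul (x y : triAlg) : triAlg :=
  (x.1.1 * y.1.1, ract x.1.2 y.1.1 + blact x.2 y.1.2, x.2 * y.2).

Fact blactDr (c : C) (m n : M) : blact c (m + n) = blact c m + blact c n.
Proof. by have := blact_linr c 1 m n; rewrite !scale1r. Qed.
Fact blactDl (c d : C) (m : M) : blact (c + d) m = blact c m + blact d m.
Proof. by have := blact_linl m 1 c d; rewrite !scale1r. Qed.
Fact blact0r (c : C) : blact c (0 : M) = 0.
Proof. by apply: (addIr (blact c 0)); rewrite -blactDr !add0r. Qed.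
Fact blact0l (m : M) : blact (0 : C) m = 0.
Proof. by apply: (addIr (blact 0 m)); rewrite -blactDl !add0r. Qed.
Fact blactZr (c : C) l (m : M) : blact c (l *: m) = l *: blact c m.
Proof. by have := blact_linr c l m 0; rewrite !addr0 blact0r addr0. Qed.
Fact blactZl l (c : C) (m : M) : blact (l *: c) m = l *: blact c m.
Proof. by have := blact_linl m l c 0; rewrite !addr0 blact0l addr0. Qed.

Fact tri_mulA : associative tri_mul.
Proof.
move=> [[b m] c] [[b' m'] c'] [[b'' m''] c'']; rewrite /tri_mul /= !mulrA.
by rewrite ractM ractDl blactDr blactM blactA addrA.
Qed.
Fact tri_mul1 : left_id tri_one tri_mul.
Proof.
by move=> [[b m] c]; rewrite /tri_mul /= !mul1r ract0l add0r blact1.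
Qed.
Fact tri_mulr1 : right_id tri_one tri_mul.
Proof.
by move=> [[b m] c]; rewrite /tri_mul /= !mulr1 ract1 blact0r addr0.
Qed.
Fact tri_mulDl : left_distributive tri_mul +%R.
Proof.
move=> [[b m] c] [[b' m'] c'] [[b'' m''] c'']; rewrite /tri_mul /= !mulrDl.
by rewrite ractDl blactDl addrACA.
Qed.
Fact tri_mulDr : right_distributive tri_mul +%R.
Proof.
move=> [[b m] c] [[b' m'] c'] [[b'' m''] c'']; rewrite /tri_mul /= !mulrDr.
by rewrite ractDr blactDr addrACA.
Qed.

Fact tri_mul_linl (y : triAlg) : linear (tri_mul^~ y).
Proof.
move=> l u v; rewrite tri_mulDl; congr (_ + _).
case: u y => [[b m] c] [[b' m'] c']; congr (_, _, _) => /=.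
- by rewrite fdscaleAl.
- by rewrite ractZl blactZl scalerDr.
- by rewrite fdscaleAl.
Qed.
Fact tri_mul_linr (x : triAlg) : linear (tri_mul x).
Proof.
move=> l u v; rewrite tri_mulDr; congr (_ + _).
case: u x => [[b m] c] [[b' m'] c']; congr (_, _, _) => /=.
- by rewrite fdscaleAr.
- by rewrite ractZr blactZr scalerDr.
- by rewrite fdscaleAr.
Qed.
HB.instance Definition _ := Vector_isFinDimAlg.Build k triAlg
  tri_mulA tri_mul1 tri_mulr1 tri_mul_linl tri_mul_linr.
HB.instance Definition _ := GRing.PzRing.copy triAlg (triAlg : fdAlgType k).

Variables (X : rightMod B) (Y : rightMod C) (f : rhom (tensor_mod Y M) X).

Fact tensorDl (y y' : Y) (m : M) : tensor (y + y') m = tensor y m + tensor y' m.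
Proof. by have := tensor_linl m 1 y y'; rewrite !scale1r. Qed.
Fact tensorDr (y : Y) (m m' : M) : tensor y (m + m') = tensor y m + tensor y m'.
Proof. by have := tensor_linr y 1 m m'; rewrite !scale1r. Qed.
Fact tensor0r (y : Y) : tensor y (0 : M) = 0.
Proof. by apply: (addIr (tensor y 0)); rewrite -tensorDr !add0r. Qed.

(* The right module (X, Y)_f: row vectors (x, y), acted on by
   (x, y) [b 0; m c] = (x b + f (y (x) m), y c). *)
Definition triple_mod : rightMod triAlg.
Proof.
refine (@RightMod k triAlg _ (fun (p : X * Y) (a : triAlg) =>
  (ract p.1 a.1.1 + f (tensor p.2 a.1.2), ract p.2 a.2)) _ _ _ _).
- move=> [[b m] c] l [x y] [x' y']; congr (_, _) => /=.
    by rewrite ractDl ractZl tensor_linl linearP scalerDr addrACA.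
  by rewrite ractDl ractZl.
- move=> [x y] l [[b m] c] [[b' m'] c']; congr (_, _) => /=.
    by rewrite ractDr ractZr tensor_linr linearP scalerDr addrACA.
  by rewrite ractDr ractZr.
- by move=> [x y]; rewrite /= !ract1 tensor0r linear0 addr0.
- move=> [x y] [[b m] c] [[b' m'] c']; congr (_, _) => /=; last exact: ractM.
  rewrite ractDl -(rhomP f) tensor_ract ractM tensorDr linearD tensor_balanced.
  by rewrite addrA.
Defined.
End Triangular.

(* Main.v *)
Require Import Defs.
From HB Require Import structures.
From Stdlib Require Import Classical.
From mathcomp Require Import all_boot all_algebra zify.

Set Implicit Arguments.
Unset Strict Implicit.
Unset Printing Implicit Defensive.

Import GRing.Theory.
Local Open Scope ring_scope.

(** Let e and e' be idempotents with X tau-tilting over B/<e> and Y tau-tilting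
    over C/<e'>. The idempotent for the glued module is d = (e, 0, e'): it kills
    (X, 0), and it kills (X_Y, Y)_f because X_Y is in Fac X. Two things remain,
    both over A/<d>: the glued module Z has as many indecomposable summands as
    A/<d>, and it is tau-rigid.

    Counting. E |-> E theta(1), for theta the inclusion of B or C in A, is an
    additive functor from A-modules to B- or C-modules. If the induced map
    End(E) -> End(E theta(1)) is onto with kernel in the radical, idempotents
    lift along it, so E and E theta(1) have equally many indecomposable
    summands (num_indec_transfer). For (X_Y, Y)_f and C the surjectivity is the
    approximation property of f and the condition on the kernel is its
    minimality, so this summand contributes |Y|; the summand (X, 0) contributes
    |X|, and no indecomposable is common to both. The same transfer applied to
    the two projectives a (A/<d>), with a the image of 1 in B or in C, gives
    |A/<d>| = |B/<e>| + |C/<e'>| (num_indec_tri_quot). Everything rests on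
    Fitting's lemma.

    Rigidity. By the formula Hom(U, D Tr V) = D coker(Hom(P0, U) -> Hom(P1, U)),
    for a minimal presentation P1 -> P0 -> V, a module V is tau-rigid if and
    only if Ext^1(V, Fac V) = 0: surjections with kernel in Fac V lift maps out
    of V (tau_rigid_lifts), and conversely it is enough that those onto V split
    (splits_tau_rigid). So let p : E -> Z be onto with kernel in Fac Z. Passing
    to E1 = E (1, 0, 0) and E2 = E (0, 0, 1), the rigidity of X and Y gives
    s0 : X -> E1 and s2 : Y -> E2 lifting the inclusions of X and Y, and shows
    that E1 is in Fac X. Hence the map
    Y (x) M -> E1 given by s2 and the action of M factors as s1 f with
    s1 : X_Y -> E1, and (s0, s1, s2) is an A-homomorphism Z -> E. Its composite
    with p is triangular, with a diagonal entry h : X_Y -> X_Y satisfying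
    h f = f, so it is bijective by minimality and p splits (glued_splits). *)

(** * Homomorphisms, submodules and factorisations *)

Lemma exists_minimum (T : Type) (P : T -> Prop) (f : T -> nat) :
  (exists x, P x) -> exists x, P x /\ forall y, P y -> (f x <= f y)%N.
Proof.
move=> exP; apply: NNPP => no; suff lt m : forall x, P x -> (m <= f x)%N.
  by case: exP => x Px; have := lt (f x).+1 x Px; rewrite ltnn.
elim: m => // m IHm x Px; rewrite ltn_neqAle IHm // andbT.
apply/eqP=> mE; apply: no; exists x; split=> // y Py.
by rewrite -mE; exact: IHm.
Qed.

Section LinearFunctions.
Variables (k : fieldType) (V W : vectType k) (F : V -> W).
Hypothesis linF : linear F.

Definition lfun_of : 'Hom(V, W) :=
  let M := GRing.isLinear.Build _ _ _ _ F linF in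
  let L : {linear V -> W} := HB.pack F M in linfun L.

Lemma lfun_ofE v : lfun_of v = F v.
Proof.
pose M := GRing.isLinear.Build _ _ _ _ F linF.
pose L : {linear _ -> _} := HB.pack F M.
exact: (lfunE L).
Qed.
End LinearFunctions.

Section Homs.
Variables (k : fieldType) (A : fdAlgType k).
Implicit Types X Y Z : rightMod A.

Section Make.
Variables (X Y : rightMod A) (F : X -> Y).
Hypotheses (linF : linear F) (actF : forall x a, F (ract x a) = ract (F x) a).
Fact mk_rhom_subproof x a :
  lfun_of linF (ract x a) = ract (lfun_of linF x) a.
Proof. by rewrite !lfun_ofE. Qed.
Definition mk_rhom : rhom X Y := RHom mk_rhom_subproof.
Lemma mk_rhomE x : mk_rhom x = F x. Proof. exact: lfun_ofE. Qed.
End Make.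

Lemma rhom_ext X Y (F : X -> Y) : linear F ->
  (forall x a, F (ract x a) = ract (F x) a) ->
  exists h : rhom X Y, forall x, h x = F x.
Proof. by move=> L Q; exists (mk_rhom L Q) => x; rewrite mk_rhomE. Qed.

Fact id_rhom_subproof X (x : X) a :
  (\1%VF : 'Hom(X, X)) (ract x a) = ract ((\1%VF : 'Hom(X, X)) x) a.
Proof. by rewrite !id_lfunE. Qed.
Definition id_rhom X : rhom X X := @RHom k A _ _ _ (@id_rhom_subproof X).

Fact comp_rhom_subproof X Y Z (g : rhom Y Z) (f : rhom X Y) x a :
  (g \o f)%VF (ract x a) = ract ((g \o f)%VF x) a.
Proof. by rewrite !comp_lfunE !rhomP. Qed.
Definition comp_rhom X Y Z (g : rhom Y Z) (f : rhom X Y) : rhom X Z :=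
  @RHom k A _ _ _ (@comp_rhom_subproof X Y Z g f).

Fact add_rhom_subproof X Y (f g : rhom X Y) x a :
  ((f : 'Hom(X, Y)) + (g : 'Hom(X, Y))) (ract x a) = ract (((f : 'Hom(X, Y)) + (g : 'Hom(X, Y))) x) a.
Proof. by rewrite !add_lfunE ractDl !rhomP. Qed.
Definition add_rhom X Y (f g : rhom X Y) : rhom X Y :=
  @RHom k A _ _ _ (@add_rhom_subproof X Y f g).

Fact sub_rhom_subproof X Y (f g : rhom X Y) x a :
  ((f : 'Hom(X, Y)) - (g : 'Hom(X, Y))) (ract x a) = ract (((f : 'Hom(X, Y)) - (g : 'Hom(X, Y))) x) a.
Proof. by rewrite !(add_lfunE, opp_lfunE) ractBl !rhomP. Qed.
Definition sub_rhom X Y (f g : rhom X Y) : rhom X Y :=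
  @RHom k A _ _ _ (@sub_rhom_subproof X Y f g).

Lemma id_rhomE X (x : X) : id_rhom X x = x.
Proof. exact: id_lfunE. Qed.
Lemma comp_rhomE X Y Z (g : rhom Y Z) (f : rhom X Y) x :
  comp_rhom g f x = g (f x).
Proof. exact: comp_lfunE. Qed.
Lemma add_rhomE X Y (f g : rhom X Y) x : add_rhom f g x = f x + g x.
Proof. exact: add_lfunE. Qed.
Lemma sub_rhomE X Y (f g : rhom X Y) x : sub_rhom f g x = f x - g x.
Proof. by rewrite /= add_lfunE opp_lfunE. Qed.
Lemma zero_rhomE X Y x : zero_hom X Y x = 0.
Proof. exact: zero_lfunE. Qed.

Fixpoint iter_rhom X (h : rhom X X) n : rhom X X :=
  if n is m.+1 then comp_rhom h (iter_rhom h m) else id_rhom X.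
Lemma iter_rhomE X (h : rhom X X) n x : iter_rhom h n x = iter n h x.
Proof. by elim: n => [|n IHn] /=; rewrite ?id_rhomE // comp_rhomE IHn. Qed.

Lemma rhomD X Y (h : rhom X Y) x y : h (x + y) = h x + h y.
Proof. exact: linearD. Qed.
Lemma rhomB X Y (h : rhom X Y) x y : h (x - y) = h x - h y.
Proof. exact: linearB. Qed.
Lemma rhomN X Y (h : rhom X Y) x : h (- x) = - h x.
Proof. exact: linearN. Qed.
Lemma rhomZ X Y (h : rhom X Y) l x : h (l *: x) = l *: h x.
Proof. exact: linearZ. Qed.
Lemma rhom0 X Y (h : rhom X Y) : h 0 = 0.
Proof. exact: linear0. Qed.
Lemma rhom_sum X Y (h : rhom X Y) I (r : seq I) (P : pred I) (F : I -> X) :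
  h (\sum_(i <- r | P i) F i) = \sum_(i <- r | P i) h (F i).
Proof. exact: linear_sum. Qed.

Lemma ract0r X (x : X) : ract x 0 = 0.
Proof. exact: linear0. Qed.

Lemma inl_rhom_ex X Y : exists i : rhom X (sum_mod X Y), forall x, i x = (x, 0).
Proof.
apply: rhom_ext => [l u v | x a] /=; congr (_, _) => /=.
  by rewrite scaler0 addr0.
by rewrite ract0l.
Qed.
Lemma inr_rhom_ex X Y : exists i : rhom Y (sum_mod X Y), forall y, i y = (0, y).
Proof.
apply: rhom_ext => [l u v | x a] /=; congr (_, _) => /=.
  by rewrite scaler0 addr0.
by rewrite ract0l.
Qed.
Lemma fst_rhom_ex X Y : exists p : rhom (sum_mod X Y) X, forall z, p z = z.1.
Proof. exact: rhom_ext. Qed.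
Lemma snd_rhom_ex X Y : exists p : rhom (sum_mod X Y) Y, forall z, p z = z.2.
Proof. exact: rhom_ext. Qed.
Lemma pair_rhom_ex X Y Z (f : rhom Z X) (g : rhom Z Y) :
  exists p : rhom Z (sum_mod X Y), forall z, p z = (f z, g z).
Proof.
by apply: rhom_ext => [l u v | x a] /=; rewrite ?linearP ?rhomP.
Qed.

Lemma bijective_rhom X Y (h : rhom X Y) :
  bijective h <-> lker h = 0%VS /\ limg h = fullv.
Proof.
split=> [bij_h | [/eqP ker_h im_h]].
  split; first by apply/eqP/lker0P; exact: bij_inj.
  have [h' _ hK'] := bij_h.
  by apply/vspaceP=> y; rewrite memvf -[y]hK' memv_img ?memvf.
exists (h^-1)%VF; first exact: lker0_lfunK.
by move=> y; rewrite limg_lfunVK // im_h memvf.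
Qed.

Lemma inj_endo_bij X (h : rhom X X) : (forall x, h x = 0 -> x = 0) -> bijective h.
Proof.
move=> h0; have ker_h : lker h = 0%VS.
  apply/eqP; rewrite -subv0; apply/subvP=> x; rewrite memv_ker => /eqP/h0 ->.
  exact: mem0v.
apply/bijective_rhom; split=> //.
apply/eqP; rewrite eqEdim subvf /=.
by have := limg_ker_dim h fullv; rewrite ker_h capv0 dimv0 add0n => ->.
Qed.

Lemma surj_endo_bij X (h : rhom X X) : limg h = fullv -> bijective h.
Proof.
move=> im_h; apply/bijective_rhom; split=> //.
have := limg_ker_dim h fullv; rewrite im_h capfv.
by move/eqP; rewrite -{2}[\dim {:X}]add0n eqn_add2r dimv_eq0 => /eqP.
Qed.

Lemma inv_rhom X Y (h : rhom X Y) : bijective h ->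
  exists g : rhom Y X, (forall x, g (h x) = x) /\ (forall y, h (g y) = y).
Proof.
case=> g hK gK.
have L : linear g.
  by move=> l u v; apply: (can_inj hK); rewrite gK linearP /= !gK.
have Q y a : g (ract y a) = ract (g y) a.
  by apply: (can_inj hK); rewrite gK rhomP gK.
have [g' g'E] := rhom_ext L Q.
by exists g'; split=> z; rewrite g'E.
Qed.

Lemma limg_is_submod X Y (h : rhom X Y) : is_submod (limg h).
Proof.
by move=> _ a /memv_imgP[x _ ->]; rewrite -rhomP memv_img ?memvf.
Qed.

Lemma lker_is_submod X Y (h : rhom X Y) : is_submod (lker h).
Proof.
by move=> x a; rewrite !memv_ker rhomP => /eqP ->; rewrite ract0l.
Qed.

Lemma factor_surj X Y Z (p : rhom X Y) (t : rhom X Z) :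
  surjective_hom p -> (forall x, p x = 0 -> t x = 0) ->
  exists s : rhom Y Z, forall x, s (p x) = t x.
Proof.
move=> p_onto kpt; pose q : 'Hom(Y, X) := (p^-1)%VF.
have qK y : p (q y) = y by rewrite limg_lfunVK // p_onto memvf.
have tE x x' : p x = p x' -> t x = t x'.
  move=> pE; apply/eqP; rewrite -subr_eq0 -rhomB; apply/eqP/kpt.
  by rewrite rhomB pE subrr.
have [s sE] : exists s : rhom Y Z, forall y, s y = t (q y).
  apply: rhom_ext => [l u v | y a]; first by rewrite !linearP.
  by rewrite -rhomP; apply: tE; rewrite rhomP !qK.
by exists s => x; rewrite sE; apply: tE; rewrite qK.
Qed.

End Homs.

Arguments limg_is_submod {k A X Y} h.
Arguments lker_is_submod {k A X Y} h.

(** * Restriction along a multiplicative map *)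

Section Restrict.
Variables (k : fieldType) (A B : fdAlgType k) (theta : 'Hom(B, A)).
Hypothesis thetaM : forall a b, theta (a * b) = theta a * theta b.
Variables (E : rightMod A) (N : {vspace E}).
Hypothesis N_stable : forall x b, x \in N -> ract x (theta b) \in N.
Hypothesis N_unit : forall x, x \in N -> ract x (theta 1) = x.

(** This covers both submodules (theta the identity of A) and the functors
    E |-> E theta(1), where theta need not preserve 1. *)
Definition restrict_mod : rightMod B.
Proof.
refine (@RightMod k B (subvs_of N)
  (fun x b => vsproj N (ract (vsval x) (theta b))) _ _ _ _).
- by move=> b l x y; rewrite !linearP /= ractDl ractZl linearP.
- by move=> x l a b; rewrite !linearP.
- by move=> x; rewrite N_unit ?subvsP // vsvalK.
- move=> x a b; rewrite thetaM ractM vsprojK //.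
  by apply: N_stable; exact: subvsP.
Defined.

Definition restrict_val (x : restrict_mod) : E := vsval (x : subvs_of N).

Lemma restrict_val_act (x : restrict_mod) b :
  restrict_val (ract x b) = ract (restrict_val x) (theta b).
Proof. by rewrite /restrict_val vsprojK // N_stable ?subvsP. Qed.

Lemma restrict_val_linear : linear restrict_val.
Proof. by []. Qed.

Lemma restrict_val_inj : injective restrict_val.
Proof. exact: val_inj. Qed.

Lemma restrict_valP x : restrict_val x \in N.
Proof. exact: subvsP. Qed.

Lemma restrict_val_onto z : z \in N -> exists x, restrict_val x = z.
Proof. by move=> zN; exists (vsproj N z); exact: vsprojK. Qed.
End Restrict.

(** * Direct summands and Fitting's lemma *)

Section Submodules.
Variables (k : fieldType) (A : fdAlgType k).
Implicit Types X Y Z U V : rightMod A.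

(** Submodules are used only through this universal property, so that their
    carriers never appear. *)
Lemma submod_ex X (N : {vspace X}) : is_submod N ->
  exists (S : rightMod A) (i : rhom S X),
    [/\ injective i, limg i = N
      & forall Y (g : rhom Y X), (forall y, g y \in N) ->
          exists h : rhom Y S, forall y, i (h y) = g y].
Proof.
move=> NP; pose th := \1%VF : 'Hom(A, A).
have thM a b : th (a * b) = th a * th b by rewrite !id_lfunE.
have st x b : x \in N -> ract x (th b) \in N by rewrite id_lfunE; exact: NP.
have un x : x \in N -> ract x (th 1) = x by rewrite id_lfunE ract1.
pose S := restrict_mod thM st un.
have [i iE] : exists i : rhom S X, forall x, i x = restrict_val x.
  apply: rhom_ext => [|x a]; first exact: restrict_val_linear.
  by rewrite restrict_val_act id_lfunE.
exists S, i; split=> [x y | | Y g gN].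
- by rewrite !iE => /restrict_val_inj.
- apply/vspaceP=> x; apply/memv_imgP/idP => [[y _ ->] | xN].
    by rewrite iE restrict_valP.
  have [y <-] := restrict_val_onto thM st un xN.
  by exists y; rewrite ?memvf ?iE.
pose h y : S := vsproj N (g y).
have hE y : restrict_val (h y) = g y by rewrite /restrict_val vsprojK.
have [h' h'E] : exists h' : rhom Y S, forall y, h' y = h y.
  apply: rhom_ext => [l u v | y a]; apply: restrict_val_inj.
    by rewrite restrict_val_linear !hE linearP.
  by rewrite restrict_val_act !hE rhomP id_lfunE.
by exists h' => y; rewrite iE h'E hE.
Qed.

Definition retract U X :=
  exists (i : rhom U X) (p : rhom X U), forall u, p (i u) = u.

(** The complement of a retract is the kernel of the retraction. *)
Lemma direct_summandP U X : direct_summand U X <-> retract U X.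
Proof.
split=> [[V [f bij_f]] | [i [p pK]]].
  have [g [fK gK]] := inv_rhom bij_f.
  have [j jE] := inl_rhom_ex U V; have [q qE] := fst_rhom_ex U V.
  exists (comp_rhom g j), (comp_rhom q f) => u.
  by rewrite !comp_rhomE gK qE jE.
have [V [j [inj_j im_j uni_j]]] := submod_ex (lker_is_submod p).
pose c := sub_rhom (id_rhom X) (comp_rhom i p).
have cE x : c x = x - i (p x) by rewrite sub_rhomE id_rhomE comp_rhomE.
have [q qE] : exists q : rhom X V, forall x, j (q x) = c x.
  by apply: uni_j => x; rewrite memv_ker cE rhomB pK subrr.
have [f fE] := pair_rhom_ex p q.
have pj v : p (j v) = 0.
  by apply/eqP; rewrite -memv_ker -im_j memv_img ?memvf.
exists V, f; exists (fun z => i z.1 + j z.2) => [x | [u v]]; rewrite fE /=.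
  by rewrite qE cE addrC subrK.
congr (_, _); first by rewrite rhomD pK pj addr0.
by apply: inj_j; rewrite qE cE rhomD pK pj addr0 addrC addKr.
Qed.

Lemma retract_trans U V X : retract U V -> retract V X -> retract U X.
Proof.
move=> [i [p pK]] [j [q qK]]; exists (comp_rhom j i), (comp_rhom p q) => u.
by rewrite !comp_rhomE qK pK.
Qed.

Lemma iso_retract U X : iso_mod U X -> retract U X.
Proof. by case=> f /inv_rhom[g [fK _]]; exists f, g. Qed.

Lemma iso_mod_sym X Y : iso_mod X Y -> iso_mod Y X.
Proof. by case=> f /inv_rhom[g [fK gK]]; exists g; exists f. Qed.

Lemma iso_mod_trans Y X Z : iso_mod X Y -> iso_mod Y Z -> iso_mod X Z.
Proof.
move=> [f bf] [g bg]; exists (comp_rhom g f).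
by apply: (eq_bij (bij_comp bg bf)) => x; rewrite comp_rhomE.
Qed.

Lemma iter_rhom0 X (h : rhom X X) n : iter n h 0 = 0.
Proof. by rewrite -iter_rhomE rhom0. Qed.

(** Fitting's lemma: a positive power H of h with the least possible rank has
    X = im H + ker H, and the projection e onto the first summand is a
    homomorphism. The power is positive so that h x = 0 implies e x = 0. *)
Lemma fitting X (h : rhom X X) :
  exists (e : rhom X X) (N : nat),
    [/\ forall x, e (e x) = e x,
        forall x, (e x = 0) <-> (iter N.+1 h x = 0)
      & forall x, (e x = x) <-> (exists y, x = iter N.+1 h y)].
Proof.
pose rk n := \dim (limg (iter_rhom h n.+1)).
have [N Nmin] : exists N, forall n, (rk N <= rk n)%N.
  have [|N [_ NP]] := @exists_minimum nat (fun=> True) rk; first by exists 0%N.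
  by exists N => n; exact: NP.
pose H := iter_rhom h N.+1.
have HE x : H x = iter N.+1 h x by exact: iter_rhomE.
have rkH : \dim (H @: limg H) = \dim (limg H).
  apply/eqP; rewrite eqn_leq; apply/andP; split.
    by apply: dimvS; apply: limgS; exact: subvf.
  apply: leq_trans (Nmin (N + N.+1)%N) _; apply: dimvS; apply/subvP => z.
  case/memv_imgP=> x _ ->; rewrite iter_rhomE -addSn iterD -!HE.
  by rewrite !memv_img ?memvf.
have cap : (limg H :&: lker H = 0)%VS.
  have := limg_ker_dim H (limg H); rewrite rkH.
  by move/eqP; rewrite -{2}[\dim (limg H)]add0n eqn_add2r dimv_eq0 => /eqP.
have sumHK x : x \in (limg H + lker H)%VS.
  suff -> : (limg H + lker H)%VS = fullv by exact: memvf.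
  apply/eqP; rewrite eqEdim subvf /= dimv_disjoint_sum //.
  by have := limg_ker_dim H fullv; rewrite capfv addnC => ->.
have cap' : (lker H :&: limg H = 0)%VS by rewrite capvC.
pose e := daddv_pi (limg H) (lker H).
have eS x : e x \in limg H by exact: memv_pi.
have eD x : x - e x \in lker H.
  by rewrite -{1}(daddv_pi_add cap (sumHK x)) addrC addKr memv_pi.
have eU u v : u \in limg H -> v \in lker H -> e (u + v) = u.
  move=> uH vH; rewrite /e linearD /= daddv_pi_id //.
  suff -> : daddv_pi (limg H) (lker H) v = 0 by rewrite addr0.
  apply: (addIr v); rewrite add0r -[in RHS](daddv_pi_add cap (sumHK v)).
  by congr (_ + _); rewrite daddv_pi_id.
have [e' e'E] : exists e' : rhom X X, forall x, e' x = e x.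
  apply: rhom_ext => [|x a]; first exact: linearP.
  rewrite -{1}(subrK (e x) x) addrC ractDl eU //; first exact: limg_is_submod.
  exact: lker_is_submod.
exists e', N; split=> x; rewrite !e'E.
- by rewrite daddv_pi_id.
- rewrite -HE; split=> [e0 | H0].
    by have := eD x; rewrite e0 subr0 memv_ker => /eqP.
  by rewrite -[x]add0r eU ?mem0v // memv_ker H0.
split=> [ex | [y ->]].
  by have := eS x; rewrite ex => /memv_imgP[y _ ->]; exists y.
by rewrite -HE -{1}[H y]addr0 eU ?mem0v // memv_img ?memvf.
Qed.

End Submodules.

(** * Indecomposable modules *)

Section Indecomposable.
Variables (k : fieldType) (A : fdAlgType k).
Implicit Types X Y Z U V T : rightMod A.

Lemma zero_mod_classic X : is_zero_mod X \/ exists x : X, x <> 0.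
Proof.
case: (classic (is_zero_mod X)) => [|no]; [by left | right].
by apply: NNPP => no'; apply: no => x; apply: NNPP => x0; apply: no'; exists x.
Qed.

Lemma indecomposableP U : indecomposable U <->
  (exists u : U, u <> 0) /\
  forall e : rhom U U, (forall x, e (e x) = e x) ->
    (forall x, e x = 0) \/ (forall x, e x = x).
Proof.
split=> [[U0 indU] | [[u u0] idemU]].
  split; first by case: (zero_mod_classic U).
  move=> e ee; have [S [i [inj_i im_i uni_i]]] := submod_ex (limg_is_submod e).
  have [p pE] : exists p : rhom U S, forall x, i (p x) = e x.
    by apply: uni_i => x; rewrite memv_img ?memvf.
  have eid x : x \in limg e -> e x = x by case/memv_imgP=> y _ ->.
  have iS s : i s \in limg e by rewrite -im_i memv_img ?memvf.
  have [V isoV] : direct_summand S U.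
    by apply/direct_summandP; exists i, p => s; apply: inj_i; rewrite pE eid.
  have [S0|V0] := indU S V isoV.
    by left=> x; rewrite -pE (S0 (p x)) rhom0.
  right=> x; have [f /inv_rhom[g [fK gK]]] := isoV.
  have [q qE] := fst_rhom_ex S V.
  have bij : bijective (comp_rhom i (comp_rhom q f)).
    apply: inj_endo_bij => y; rewrite !comp_rhomE => iy0.
    have qy0 : q (f y) = 0 by apply: inj_i; rewrite iy0 rhom0.
    by rewrite -[y]fK [f y]surjective_pairing -qE qy0 (V0 (f y).2) rhom0.
  have [h _ hK] := bij; apply: eid.
  by rewrite -[x]hK !comp_rhomE.
split=> [U0 | P Q [f /inv_rhom[g [fK gK]]]]; first exact/u0/U0.
have [j jE] := inl_rhom_ex P Q; have [q qE] := fst_rhom_ex P Q.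
pose e := comp_rhom g (comp_rhom j (comp_rhom q f)).
have eE x : e x = g ((f x).1, 0) by rewrite !comp_rhomE jE qE.
have [|e0|e1] := idemU e; first by move=> x; rewrite !eE gK.
- left=> x; have := e0 (g (x, 0)); rewrite eE gK /= => gx0.
  by have := gK (x, 0); rewrite gx0 rhom0 => -[].
- right=> y; have := e1 (g (0, y)); rewrite eE gK /=.
  by move/(congr1 f); rewrite !gK => -[].
Qed.

(** Fitting: the endomorphism ring of an indecomposable module is local. *)
Lemma endo_bij_or_nilp U (h : rhom U U) : indecomposable U ->
  bijective h \/ exists N, forall x, iter N h x = 0.
Proof.
move=> /indecomposableP[_ idemU]; have [e [N [ee e0 e1]]] := fitting h.
have [z|o] := idemU e ee.
  by right; exists N.+1 => x; apply/e0.
left; apply: surj_endo_bij; apply/vspaceP=> x; rewrite memvf.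
by have /e1[y ->] := o x; rewrite iterS memv_img ?memvf.
Qed.

Lemma indecomposable_iso U V :
  iso_mod U V -> indecomposable U -> indecomposable V.
Proof.
move=> [f /inv_rhom[g [fK gK]]] /indecomposableP[[u u0] idemU].
apply/indecomposableP; split.
  by exists (f u) => fu0; apply: u0; rewrite -[u]fK fu0 rhom0.
move=> e ee; have [|z|o] := idemU (comp_rhom g (comp_rhom e f)).
- by move=> x; rewrite !comp_rhomE gK ee.
- left=> x; have := z (g x); rewrite !comp_rhomE gK => /(congr1 f).
  by rewrite gK rhom0.
- right=> x; have := o (g x); rewrite !comp_rhomE gK => /(congr1 f).
  by rewrite !gK.
Qed.

(** The exchange property behind the Krull-Schmidt theorem: the identity of T
    is a sum of two endomorphisms factoring through X and through Y, and these
    cannot both be nilpotent. *)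
Lemma indec_retract_sum T X Y : indecomposable T ->
  retract T (sum_mod X Y) -> retract T X \/ retract T Y.
Proof.
move=> indT [i [p pK]].
have [jX jXE] := inl_rhom_ex X Y; have [jY jYE] := inr_rhom_ex X Y.
have [qX qXE] := fst_rhom_ex X Y; have [qY qYE] := snd_rhom_ex X Y.
pose a := comp_rhom (comp_rhom p jX) (comp_rhom qX i).
pose b := comp_rhom (comp_rhom p jY) (comp_rhom qY i).
have ret (W : rightMod A) (u : rhom T W) (v : rhom W T) :
    bijective (comp_rhom v u) -> retract T W.
  case/inv_rhom=> c [cK _]; exists u, (comp_rhom c v) => x.
  by rewrite comp_rhomE -[RHS]cK comp_rhomE.
have abE x : a x + b x = x.
  rewrite !comp_rhomE -rhomD jXE jYE qXE qYE -[RHS]pK; congr (p _).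
  by rewrite [RHS]surjective_pairing; congr (_, _); rewrite /= ?addr0 ?add0r.
have [bij_a|[N aN]] := endo_bij_or_nilp a indT; first by left; exact: ret bij_a.
right; apply: ret (_ : bijective b); apply: inj_endo_bij => x bx0.
have ax : a x = x by rewrite -[RHS]abE bx0 addr0.
by rewrite -(aN x); elim: N {aN} => //= n <-; rewrite ax.
Qed.

Lemma retract_inl X Y : retract X (sum_mod X Y).
Proof.
have [j jE] := inl_rhom_ex X Y; have [q qE] := fst_rhom_ex X Y.
by exists j, q => x; rewrite qE jE.
Qed.
Lemma retract_inr X Y : retract Y (sum_mod X Y).
Proof.
have [j jE] := inr_rhom_ex X Y; have [q qE] := snd_rhom_ex X Y.
by exists j, q => x; rewrite qE jE.
Qed.

(** * Counting indecomposable summands *)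

Lemma num_indec_iso X Y n : iso_mod X Y -> num_indec X n -> num_indec Y n.
Proof.
move=> isoXY [S [SP Sinj Sall]]; exists S; split=> // [i | U indU UY].
  have [indS /direct_summandP SX] := SP i; split=> //.
  by apply/direct_summandP; exact: retract_trans (iso_retract isoXY).
apply: Sall => //; move/direct_summandP: UY => UY; apply/direct_summandP.
by apply: retract_trans (iso_retract _); [exact: UY | exact: iso_mod_sym].
Qed.

Lemma num_indec_sum X Y m n :
  (forall T, indecomposable T -> retract T X -> retract T Y -> False) ->
  num_indec X m -> num_indec Y n -> num_indec (sum_mod X Y) (m + n).
Proof.
move=> disj [S [SP Sinj Sall]] [R [RP Rinj Rall]].
pose F (s : 'I_m + 'I_n) := match s with inl i => S i | inr j => R j end.
have sep i j : iso_mod (S i) (R j) -> False.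
  move=> iso; have [indS /direct_summandP SX] := SP i.
  have [_ /direct_summandP RY] := RP j.
  exact: disj indS SX (retract_trans (iso_retract iso) RY).
exists (fun i => F (split i)); split=> [i | i j | U indU].
- case: (split i) => j /=.
    have [indS /direct_summandP SX] := SP j; split=> //.
    by apply/direct_summandP; exact: retract_trans SX (retract_inl _ _).
  have [indR /direct_summandP RY] := RP j; split=> //.
  by apply/direct_summandP; exact: retract_trans RY (retract_inr _ _).
- move=> iso; rewrite -[i]splitK -[j]splitK; congr unsplit; move: iso.
  case: (split i) (split j) => i' [] j' /= iso.
  + by rewrite (Sinj _ _ iso).
  + by case: (sep _ _ iso).
  + by case: (sep _ _ (iso_mod_sym iso)).
  + by rewrite (Rinj _ _ iso).
- move=> /direct_summandP US.
  case: (indec_retract_sum indU US) => /direct_summandP UX.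
    have [i iso] := Sall U indU UX; exists (unsplit (inl i)).
    by rewrite unsplitK.
  have [i iso] := Rall U indU UX; exists (unsplit (inr i)).
  by rewrite unsplitK.
Qed.

End Indecomposable.

(** * Transfer of the count along E |-> E theta(1) *)

Section Corner.
Variables (k : fieldType) (A B : fdAlgType k) (theta : 'Hom(B, A)).
Hypothesis thetaM : forall a b, theta (a * b) = theta a * theta b.
Implicit Types E T Z : rightMod A.

Definition corner_space E : {vspace E} :=
  limg (linfun (ractr (X := E) (theta 1))).

Lemma corner_spaceP E (x : E) :
  reflect (ract x (theta 1) = x) (x \in corner_space E).
Proof.
have aE y : linfun (ractr (X := E) (theta 1)) y = ract y (theta 1).
  by rewrite lfunE.
apply: (iffP idP) => [/memv_imgP[y _ ->] | <-].
  by rewrite aE -ractM -thetaM mulr1.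
by rewrite -aE memv_img ?memvf.
Qed.

Fact corner_stable E (x : E) b :
  x \in corner_space E -> ract x (theta b) \in corner_space E.
Proof. by move=> _; apply/corner_spaceP; rewrite -ractM -thetaM mulr1. Qed.

Fact corner_unit E (x : E) : x \in corner_space E -> ract x (theta 1) = x.
Proof. by move/corner_spaceP. Qed.

(** The B-module E theta(1). *)
Definition corner E : rightMod B :=
  restrict_mod thetaM (@corner_stable E) (@corner_unit E).

Definition corner_val E (x : corner E) : E := restrict_val x.

Lemma corner_val_act E (x : corner E) b :
  corner_val (ract x b) = ract (corner_val x) (theta b).
Proof. exact: restrict_val_act. Qed.
Lemma corner_val_linear E : linear (@corner_val E).
Proof. exact: restrict_val_linear. Qed.
Lemma corner_val_inj E : injective (@corner_val E).
Proof. exact: restrict_val_inj. Qed.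
Lemma corner_val1 E (x : corner E) : ract (corner_val x) (theta 1) = corner_val x.
Proof. exact/corner_spaceP/restrict_valP. Qed.
Lemma corner_val_onto E (z : E) : ract z (theta 1) = z ->
  exists x : corner E, corner_val x = z.
Proof. by move/corner_spaceP; exact: restrict_val_onto. Qed.
Lemma corner_val0 E : corner_val (0 : corner E) = 0.
Proof. by []. Qed.

Lemma corner_hom_ex (X : rightMod B) E (F : X -> E) : linear F ->
  (forall x b, F (ract x b) = ract (F x) (theta b)) ->
  exists h : rhom X (corner E), forall x, corner_val (h x) = F x.
Proof.
move=> linF actF; pose h x : corner E := vsproj (corner_space E) (F x).
have hE x : corner_val (h x) = F x.
  rewrite /corner_val /restrict_val vsprojK //; apply/corner_spaceP.
  by rewrite -actF ract1.
have [h' h'E] : exists h' : rhom X (corner E), forall x, h' x = h x.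
  apply: rhom_ext => [l u v | x b]; apply: corner_val_inj.
    by rewrite corner_val_linear !hE linF.
  by rewrite corner_val_act !hE actF.
by exists h' => x; rewrite h'E.
Qed.

Lemma corner_map E T (h : rhom E T) :
  exists g : rhom (corner E) (corner T),
    forall x, corner_val (g x) = h (corner_val x).
Proof.
apply: corner_hom_ex => [l u v | x b]; last by rewrite corner_val_act rhomP.
by rewrite corner_val_linear linearP.
Qed.

Variable Z : rightMod A.
(** Bijectivity of the endomorphisms that restrict to the identity says that
    the kernel of End(Z) -> End(Z theta(1)) lies in the radical. *)
Hypothesis reflect_id : forall h : rhom Z Z,
  (forall z, ract z (theta 1) = z -> h z = z) -> bijective h.

(** With T theta(1) = 0, the complementary idempotent 1 - ip is the identity on
    Z theta(1), hence bijective, and it kills T. *)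
Lemma retract_corner_neq0 T : retract T Z ->
  (forall t : T, ract t (theta 1) = 0) -> is_zero_mod T.
Proof.
move=> [i [p pK]] T0; pose h := sub_rhom (id_rhom Z) (comp_rhom i p).
have hE z : h z = z - i (p z) by rewrite sub_rhomE id_rhomE comp_rhomE.
have bij : bijective h.
  apply: reflect_id => z zE; rewrite hE -[in i _]zE rhomP T0 rhom0.
  by rewrite subr0.
move=> t; rewrite -(pK t) -(rhom0 p); congr (p _); apply: (bij_inj bij).
by rewrite hE pK subrr rhom0.
Qed.

Hypothesis lift_endo : forall b : rhom (corner Z) (corner Z),
  exists h : rhom Z Z, forall x, h (corner_val x) = corner_val (b x).

Lemma lift_retract_hom T T' : retract T Z -> retract T' Z ->
  forall b : rhom (corner T) (corner T'),
  exists h : rhom T T', forall x, h (corner_val x) = corner_val (b x).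
Proof.
move=> [i [p pK]] [i' [p' p'K]] b.
have [gp gpE] := corner_map p; have [gi giE] := corner_map i'.
have [h hE] := lift_endo (comp_rhom gi (comp_rhom b gp)).
exists (comp_rhom p' (comp_rhom h i)) => x; rewrite !comp_rhomE.
have [y yE] : exists y : corner Z, corner_val y = i (corner_val x).
  by apply: corner_val_onto; rewrite -rhomP corner_val1.
rewrite -yE hE !comp_rhomE giE p'K; congr (corner_val (b _)).
by apply: corner_val_inj; rewrite gpE yE pK.
Qed.

Lemma corner_nonzero T : indecomposable T -> retract T Z ->
  exists x : corner T, x <> 0.
Proof.
move=> /indecomposableP[[u u0] _] TZ; apply: NNPP => no; apply: u0.
apply: retract_corner_neq0 u => // t.
have [|x xE] := @corner_val_onto T (ract t (theta 1)).
  by rewrite -ractM -thetaM mulr1.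
rewrite -xE; case: (classic (x = 0)) => [-> // | x0].
by case: no; exists x.
Qed.

Lemma corner_id_bij T (h : rhom T T) : indecomposable T -> retract T Z ->
  (forall x : corner T, h (corner_val x) = corner_val x) -> bijective h.
Proof.
move=> indT TZ hid; have [//|[N hN]] := endo_bij_or_nilp h indT.
have [x x0] := corner_nonzero indT TZ; case: x0; apply: corner_val_inj.
by rewrite corner_val0 -(hN (corner_val x)); elim: N {hN} => //= N <-.
Qed.

Lemma corner_indecomposable T : indecomposable T -> retract T Z ->
  indecomposable (corner T).
Proof.
move=> indT TZ; apply/indecomposableP; split; first exact: corner_nonzero.
move=> b bb; have [h hE] := lift_retract_hom TZ TZ b.
have [bij|[N hN]] := endo_bij_or_nilp h indT.
  right=> x; apply/corner_val_inj/(bij_inj bij).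
  by rewrite !hE bb.
left=> x; apply: corner_val_inj; rewrite corner_val0.
suff -> : corner_val (b x) = iter N h (corner_val (b x)) by rewrite hN.
by elim: N {hN} => //= n <-; rewrite hE bb.
Qed.

Lemma corner_retract T : retract T Z -> retract (corner T) (corner Z).
Proof.
move=> [i [p pK]]; have [gi giE] := corner_map i; have [gp gpE] := corner_map p.
by exists gi, gp => x; apply: corner_val_inj; rewrite gpE giE pK.
Qed.

Lemma corner_iso_mod T T' : iso_mod T T' -> iso_mod (corner T) (corner T').
Proof.
move=> [f /inv_rhom[g [fK gK]]].
have [cf cfE] := corner_map f; have [cg cgE] := corner_map g.
by exists cf; exists cg => x; apply: corner_val_inj; rewrite ?cfE ?cgE ?cfE.
Qed.

Lemma corner_reflect_iso T T' :
  indecomposable T -> indecomposable T' -> retract T Z -> retract T' Z ->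
  iso_mod (corner T) (corner T') -> iso_mod T T'.
Proof.
move=> indT indT' TZ TZ' [f /inv_rhom[g [fK gK]]].
have [u uE] := lift_retract_hom TZ TZ' f.
have [v vE] := lift_retract_hom TZ' TZ g.
have [a aK _] : bijective (comp_rhom v u).
  by apply: corner_id_bij => // x; rewrite comp_rhomE uE vE fK.
have [b _ bK] : bijective (comp_rhom u v).
  by apply: corner_id_bij => // x; rewrite comp_rhomE vE uE gK.
exists u; apply/bijective_rhom; split.
  apply/eqP/lker0P => x y uxy; apply: (can_inj aK).
  by rewrite !comp_rhomE uxy.
by apply/vspaceP=> y; rewrite memvf -[y]bK comp_rhomE memv_img ?memvf.
Qed.

(** Idempotents of End(Z theta(1)) lift to idempotents of End(Z): the Fitting
    projection of any lift is one, because a lift already acts as the identity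
    on one part of Z theta(1) and as zero on the other. *)
Lemma corner_lift_summand S : indecomposable S -> retract S (corner Z) ->
  exists T, [/\ indecomposable T, retract T Z & iso_mod (corner T) S].
Proof.
move=> indS [i [p pK]].
have [h hE] := lift_endo (comp_rhom i p).
have [e [N [ee e0 e1]]] := fitting h.
have eE x : e (corner_val x) = corner_val (i (p x)).
  rewrite -[x in LHS](subrK (i (p x))) addrC.
  have lin : corner_val (i (p x) + (x - i (p x))) =
      corner_val (i (p x)) + corner_val (x - i (p x)) by [].
  rewrite lin rhomD.
  have -> : e (corner_val (i (p x))) = corner_val (i (p x)).
    apply/e1; exists (corner_val (i (p x))).
    by elim: (N.+1) => //= n <-; rewrite hE !comp_rhomE pK.
  have -> : e (corner_val (x - i (p x))) = 0.
    apply/e0; rewrite iterSr hE !comp_rhomE rhomB pK subrr rhom0 corner_val0.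
    exact: iter_rhom0.
  exact: addr0.
have [T [j [inj_j im_j uni_j]]] := submod_ex (limg_is_submod e).
have [r rE] : exists r : rhom Z T, forall z, j (r z) = e z.
  by apply: uni_j => z; rewrite memv_img ?memvf.
have rK t : r (j t) = t.
  apply: inj_j; rewrite rE; have: j t \in limg e by rewrite -im_j memv_img ?memvf.
  by case/memv_imgP=> z _ ->.
have TZ : retract T Z by exists j, r.
have iso : iso_mod (corner T) S.
  have [gj gjE] := corner_map j; have [gr grE] := corner_map r.
  exists (comp_rhom p gj); exists (comp_rhom gr i) => x; rewrite !comp_rhomE.
    apply: corner_val_inj; rewrite grE; apply: inj_j.
    by rewrite rE -gjE eE pK -eE gjE -rE rK.
  rewrite -[RHS]pK -[RHS]pK; congr (p _); apply: corner_val_inj.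
  by rewrite gjE grE rE eE.
exists T; split=> //.
have indC := indecomposable_iso (iso_mod_sym iso) indS.
have [[c c0] idemC] := (indecomposableP _).1 indC.
apply/indecomposableP; split.
  exists (corner_val c) => cv0; apply: c0; apply: corner_val_inj.
  by rewrite cv0.
(* The image of d is a summand T' of Z with T' theta(1) = 0. *)
have vanish (d : rhom T T) : (forall x, d (d x) = d x) ->
    (forall x : corner T, d (corner_val x) = 0) -> forall x, d x = 0.
  move=> dd d0; have [T' [j' [inj_j' im_j' uni_j']]] :=
    submod_ex (limg_is_submod d).
  have [r' r'E] : exists r' : rhom T T', forall z, j' (r' z) = d z.
    by apply: uni_j' => z; rewrite memv_img ?memvf.
  have jd t : d (j' t) = j' t.
    have: j' t \in limg d by rewrite -im_j' memv_img ?memvf.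
    by case/memv_imgP=> z _ ->.
  have T'T : retract T' T by exists j', r' => t; apply: inj_j'; rewrite r'E jd.
  have T'0 := retract_corner_neq0 (retract_trans T'T TZ).
  move=> x; rewrite -r'E (T'0 _ (r' x)) ?rhom0 // => t.
  apply: inj_j'; rewrite rhom0 -jd rhomP.
  have [|y <-] := @corner_val_onto T (ract (j' t) (theta 1)); last exact: d0.
  by rewrite -ractM -thetaM mulr1.
move=> d dd; have [cd cdE] := corner_map d.
have [|z|o] := idemC cd.
- by move=> x; apply: corner_val_inj; rewrite !cdE dd.
- by left; apply: vanish => // x; rewrite -cdE z.
right=> x; apply/eqP; rewrite eq_sym -subr_eq0; apply/eqP.
have := @vanish (sub_rhom (id_rhom T) d) _ _ x; rewrite sub_rhomE id_rhomE.
apply=> y; rewrite !sub_rhomE !id_rhomE; last by rewrite -cdE o subrr.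
by rewrite rhomB dd subrr subr0.
Qed.

(** T |-> T theta(1) is a bijection from the isomorphism classes of
    indecomposable summands of Z to those of Z theta(1). *)
Lemma num_indec_corner n : num_indec (corner Z) n -> num_indec Z n.
Proof.
case=> S [SP Sinj Sall].
have [T TP] : exists T : 'I_n -> rightMod A, forall i,
    [/\ indecomposable (T i), retract (T i) Z & iso_mod (corner (T i)) (S i)].
  have: forall i : 'I_n, exists T : rightMod A,
    [/\ indecomposable T, retract T Z & iso_mod (corner T) (S i)].
    move=> i; have [indS /direct_summandP SZ] := SP i.
    exact: corner_lift_summand.
  exact: fin_all_exists.
exists T; split=> [i | i j isoT | U indU /direct_summandP UZ].
- by have [indT TZ _] := TP i; split=> //; apply/direct_summandP.
- have [_ _ isoi] := TP i; have [_ _ isoj] := TP j; apply: Sinj.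
  apply: iso_mod_trans (iso_mod_sym isoi) _.
  exact: iso_mod_trans (corner_iso_mod isoT) isoj.
have [i isoi] := Sall (corner U) (corner_indecomposable indU UZ)
  ((direct_summandP _ _).2 (corner_retract UZ)).
have [indT TZ iso] := TP i; exists i; apply: corner_reflect_iso => //.
exact: iso_mod_trans isoi (iso_mod_sym iso).
Qed.

End Corner.

(** The form in which the transfer is used: phi identifies Y with the corner
    Z theta(1). *)
Lemma num_indec_transfer (k : fieldType) (A B : fdAlgType k)
    (theta : 'Hom(B, A)) (Z : rightMod A) (Y : rightMod B) (phi : 'Hom(Y, Z)) :
  (forall a b, theta (a * b) = theta a * theta b) ->
  injective phi ->
  (forall z, ract z (theta 1) = z -> exists y, phi y = z) ->
  (forall y b, phi (ract y b) = ract (phi y) (theta b)) ->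
  (forall b : rhom Y Y, exists h : rhom Z Z, forall y, h (phi y) = phi (b y)) ->
  (forall h : rhom Z Z, (forall y, h (phi y) = phi y) -> bijective h) ->
  forall n, num_indec Y n -> num_indec Z n.
Proof.
move=> thM inj_phi phi_onto phi_act lift refl n numY.
have phi_lin : linear phi by exact: linearP.
have [f fE] := corner_hom_ex thM phi_lin phi_act.
have bij_f : bijective f.
  apply/bijective_rhom; split.
    by apply/eqP/lker0P => x y fxy; apply: inj_phi; rewrite -!fE fxy.
  apply/vspaceP=> x; rewrite memvf.
  have [y yE] := phi_onto _ (corner_val1 x); apply/memv_imgP.
  by exists y; rewrite ?memvf //; apply: corner_val_inj; rewrite fE yE.
have [g [fK gK]] := inv_rhom bij_f.
have vE x : corner_val x = phi (g x) by rewrite -fE gK.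
apply: (num_indec_corner (thetaM := thM)).
- by move=> h hid; apply: refl => y; apply: hid; rewrite -phi_act ract1.
- move=> b; have [h hE] := lift (comp_rhom g (comp_rhom b f)).
  by exists h => x; rewrite vE hE !comp_rhomE gK -vE.
by apply: num_indec_iso numY; exists f.
Qed.

(** * Projective modules and minimal presentations *)

Section Projectives.
Variables (k : fieldType) (A : fdAlgType k).
Implicit Types X Y Z U V E P : rightMod A.

Lemma pow_copair_ex X E n (h : 'I_n -> rhom X E) :
  exists g : rhom (pow_mod X n) E, forall c, g c = \sum_j h j (c j).
Proof.
apply: rhom_ext => [l u v | c a].
  rewrite scaler_sumr -big_split; apply: eq_bigr => j _ /=.
  by rewrite !ffunE linearP.
rewrite ract_suml; apply: eq_bigr => j _ /=.
by rewrite ffunE rhomP.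
Qed.

Lemma pow_pair_ex X E n (h : 'I_n -> rhom E X) :
  exists g : rhom E (pow_mod X n), forall e j, g e j = h j e.
Proof.
have [||g gE] := @rhom_ext k A E (pow_mod X n) (fun e => [ffun j => h j e]).
- by move=> l u v; apply/ffunP=> j; rewrite !ffunE linearP.
- by move=> e a; apply/ffunP=> j; rewrite !ffunE rhomP.
by exists g => e j; rewrite gE ffunE.
Qed.

Lemma pow_proj_ex X n (j : 'I_n) :
  exists g : rhom (pow_mod X n) X, forall c, g c = c j.
Proof. by apply: rhom_ext => [l u v | c a] /=; rewrite !ffunE. Qed.

Lemma pow_inj_ex X n (j : 'I_n) : exists g : rhom X (pow_mod X n),
  forall x i, g x i = if i == j then x else 0.
Proof.
have [g gE] := @pow_pair_ex X X n
  (fun i => if i == j then id_rhom X else zero_hom X X).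
exists g => x i; rewrite gE; case: eqP => _.
  exact: id_rhomE.
exact: zero_rhomE.
Qed.

Lemma surj_homP X Y (f : rhom X Y) :
  surjective_hom f <-> forall y, exists x, f x = y.
Proof.
split=> [f_onto y | f_onto].
  have: y \in limg f by rewrite f_onto memvf.
  by case/memv_imgP=> x _ ->; exists x.
apply/vspaceP=> y; rewrite memvf; have [x <-] := f_onto y.
by rewrite memv_img ?memvf.
Qed.

Lemma limg_mem X Y (f : rhom X Y) x : f x \in limg f.
Proof. by rewrite memv_img ?memvf. Qed.

Lemma projective_lift P X E (g : rhom X E) (f : rhom P E) :
  projective P -> (forall y, f y \in limg g) ->
  exists h : rhom P X, forall y, g (h y) = f y.
Proof.
move=> projP fg; have [S [i [inj_i im_i uni_i]]] := submod_ex (limg_is_submod g).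
have [g' g'E] := uni_i _ g (limg_mem g); have [f' f'E] := uni_i _ f fg.
have [|h hE] := projP _ _ g' _ f'.
  apply/surj_homP => s; have : i s \in limg g by rewrite -im_i limg_mem.
  case/memv_imgP=> x _ isE; exists x; apply: inj_i.
  by rewrite g'E isE.
by exists h => y; rewrite -g'E hE f'E.
Qed.

Lemma retract_projective P Q : retract P Q -> projective Q -> projective P.
Proof.
move=> [i [p pK]] projQ X Y g g_onto f.
have [h hE] := projQ _ _ g g_onto (comp_rhom f p).
by exists (comp_rhom h i) => x; rewrite comp_rhomE hE comp_rhomE pK.
Qed.

Lemma reg_hom_ex X (x : X) :
  exists h : rhom (reg_mod A) X, forall a, h a = ract x a.
Proof.
apply: rhom_ext => [l a b | a b] /=; last exact: ractM.
by rewrite ractDr ractZr.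
Qed.

Lemma free_projective n : projective (pow_mod (reg_mod A) n).
Proof.
move=> X Y g /surj_homP g_onto f.
pose d (j : 'I_n) : pow_mod (reg_mod A) n :=
  [ffun i => if i == j then 1 else 0].
have [y yP] : exists y : 'I_n -> X, forall j, g (y j) = f (d j).
  exact: (@fin_all_exists _ (fun=> X) (fun j y => g y = f (d j))).
have [e eE] : exists e : 'I_n -> rhom (reg_mod A) X, forall j a,
    e j a = ract (y j) a.
  have: forall j, exists e : rhom (reg_mod A) X, forall a, e a = ract (y j) a.
    by move=> j; exact: reg_hom_ex.
  exact: fin_all_exists.
have [h hE] := pow_copair_ex e; exists h => c.
rewrite hE rhom_sum.
have cE : c = \sum_j ract (d j) (c j).
  apply/ffunP=> i; rewrite sum_ffunE (bigD1 i) //= !ffunE eqxx mul1r.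
  rewrite big1 ?addr0 // => j /negPf ji.
  by rewrite !ffunE eq_sym ji mul0r.
rewrite [in RHS]cE rhom_sum; apply: eq_bigr => j _.
by rewrite eE rhomP yP rhomP.
Qed.

Lemma free_cover V :
  exists n (p : rhom (pow_mod (reg_mod A) n) V), surjective_hom p.
Proof.
pose b (j : 'I_(\dim {:V})) := (vbasis {:V})`_j.
have [e eE] : exists e : 'I_(\dim {:V}) -> rhom (reg_mod A) V, forall j a,
    e j a = ract (b j) a.
  have: forall j, exists e : rhom (reg_mod A) V, forall a, e a = ract (b j) a.
    by move=> j; exact: reg_hom_ex.
  exact: fin_all_exists.
have [p pE] := pow_copair_ex e; exists (\dim {:V}), p; apply/surj_homP => v.
pose c : {ffun 'I_(\dim {:V}) -> A} := 
  [ffun j => (coord (vbasis {:V}) j v *: (1 : A) : A)].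
exists (c : pow_mod (reg_mod A) _); rewrite pE.
rewrite [RHS](coord_vbasis (memvf v)); apply: eq_bigr => j _.
by rewrite ffunE eE ractZr ract1.
Qed.

(** The dual basis lemma: P is a summand of a free module. *)
Lemma dual_basis P : projective P ->
  exists n (x : 'I_n -> P) (g : 'I_n -> rhom P (reg_mod A)),
    forall y, y = \sum_j ract (x j) (g j y).
Proof.
move=> projP; have [n [p p_onto]] := free_cover P.
have [i iE] := projP _ _ p p_onto (id_rhom P).
have [q qE] : exists q : 'I_n -> rhom (pow_mod (reg_mod A) n) (reg_mod A),
    forall j c, q j c = c j.
  have: forall j : 'I_n, exists q : rhom (pow_mod (reg_mod A) n) (reg_mod A),
    forall c, q c = c j by move=> j; exact: pow_proj_ex.
  exact: fin_all_exists.
pose d (j : 'I_n) : pow_mod (reg_mod A) n :=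
  [ffun i => if i == j then 1 else 0].
exists n, (fun j => p (d j)),
  (fun j => comp_rhom (q j) i) => y.
rewrite -{1}(id_rhomE y) -iE.
under [RHS]eq_bigr => j _ do rewrite comp_rhomE qE -rhomP.
rewrite -rhom_sum; congr (p _); apply/ffunP=> l.
rewrite sum_ffunE (bigD1 l) //= !ffunE eqxx mul1r big1 ?addr0 // => j /negPf jl.
by rewrite !ffunE eq_sym jl mul0r.
Qed.

(** A projective of least dimension mapping onto V is a projective cover: if
    ker p + N' = P, the lift h of p through N' is an endomorphism with
    p h = p, and the image of its Fitting projection is a projective mapping
    onto V, hence all of P. *)
Lemma projective_cover V : exists P (p : rhom P V),
  [/\ projective P, surjective_hom p & superfluous (lker p)].
Proof.
pose OK (P : rightMod A) := projective P /\ exists p : rhom P V, surjective_hom p.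
have [|P [[projP [p /surj_homP p_onto]] Pmin]] :=
  @exists_minimum (rightMod A) OK (fun P => \dim {:P}).
  have [n [p p_onto]] := free_cover V; exists (pow_mod (reg_mod A) n).
  by split; [exact: free_projective | exists p].
exists P, p; split=> // [|N' N'P sumN]; first exact/surj_homP.
have [S [i [inj_i im_i _]]] := submod_ex N'P.
have [h0 h0E] : exists h0 : rhom P S, forall x, comp_rhom p i (h0 x) = p x.
  apply: projective_lift => // x.
  have : x \in (lker p + N')%VS by rewrite sumN memvf.
  case/memv_addP=> u up [v vN ->].
  move: up; rewrite memv_ker rhomD => /eqP ->; rewrite add0r.
  move: vN; rewrite -im_i => /memv_imgP[s _ ->].
  by rewrite -comp_rhomE limg_mem.
pose h := comp_rhom i h0.
have ph x : p (h x) = p x by rewrite -[RHS]h0E !comp_rhomE.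
have [e [N [ee e0 e1]]] := fitting h.
have [T [j [inj_j im_j uni_j]]] := submod_ex (limg_is_submod e).
have [r rE] := uni_j _ e (limg_mem e).
have TP : retract T P.
  exists j, r => t; apply: inj_j; rewrite rE.
  have : j t \in limg e by rewrite -im_j limg_mem.
  by case/memv_imgP=> z _ ->.
have pe x : p (e x) = p x.
  have pI n y : p (iter n h y) = p y by elim: n => //= n IHn; rewrite ph.
  rewrite -[RHS]subr0 -[LHS]subr0 -[in RHS](subrK (e x) x) rhomD.
  suff -> : p (x - e x) = 0 by rewrite add0r.
  rewrite -(pI N.+1) (e0 _).1 ?rhom0 //.
  by rewrite rhomB ee subrr.
have leP : (\dim {:P} <= \dim {:T})%N.
  apply: Pmin; split; first exact: retract_projective TP projP.
  exists (comp_rhom p j); apply/surj_homP => v; have [x <-] := p_onto v.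
  by exists (r x); rewrite comp_rhomE rE pe.
have dimT : \dim {:T} = \dim (limg e).
  have := limg_ker_dim j fullv.
  have /eqP -> : lker j == 0%VS by exact/lker0P.
  by rewrite capv0 dimv0 add0n im_j.
have e_onto : limg e = fullv by apply/eqP; rewrite eqEdim subvf -dimT.
apply/vspaceP=> x; rewrite memvf.
have : x \in limg e by rewrite e_onto memvf.
case/memv_imgP=> z _ ->; have /e1[y ->] := ee z.
by rewrite iterS comp_rhomE -im_i limg_mem.
Qed.

Lemma min_proj_pres_ex V : exists P1 P0 (p1 : rhom P1 P0) (p0 : rhom P0 V),
  min_proj_pres p1 p0.
Proof.
have [P0 [p0 [proj0 onto0 sup0]]] := projective_cover V.
have [K [i [inj_i im_i _]]] := submod_ex (lker_is_submod p0).
have [P1 [q [proj1 /surj_homP onto1 sup1]]] := projective_cover K.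
exists P1, P0, (comp_rhom i q), p0; split=> //.
  split=> //; rewrite -im_i; apply/vspaceP=> y.
  apply/memv_imgP/memv_imgP => -[x _ ->].
    by exists (q x); rewrite ?memvf ?comp_rhomE.
  by have [z <-] := onto1 x; exists z; rewrite ?memvf ?comp_rhomE.
suff -> : lker (comp_rhom i q) = lker q by [].
apply/vspaceP=> x; rewrite !memv_ker comp_rhomE.
apply/eqP/eqP => [|->]; last exact: rhom0.
by rewrite -(rhom0 i) => /inj_i.
Qed.

End Projectives.

(** * The Auslander-Reiten translate and lifting *)

Section Translate.
Variables (k : fieldType) (A : fdAlgType k).
Implicit Types X Y Z U V E F P : rightMod A.

(** Surjectivity of Hom(P0, U) -> Hom(P1, U). When p1 is the first map of a
    minimal presentation of V, the dual of the cokernel is Hom(U, D Tr V). *)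
Definition extends_along P1 P0 (p1 : rhom P1 P0) U :=
  forall g : rhom P1 U, exists h : rhom P0 U, forall x, h (p1 x) = g x.

Lemma separating_functional (W : vectType k) (S : {vspace W}) v : v \notin S ->
  exists lam : 'Hom(W, k^o), (forall s, s \in S -> lam s = 0) /\ lam v != 0.
Proof.
move=> vS; have qv : quotv_pi S v != 0 by rewrite quotv_pi_eq0.
have linc (i : 'I_(\dim {:quotv S})) :
    linear (fun w => coord (vbasis {:quotv S}) i (quotv_pi S w) : k^o).
  by move=> l x y; rewrite !linearP.
have [i ci] : exists i, coord (vbasis {:quotv S}) i (quotv_pi S v) != 0.
  apply/existsP; apply: contraNT qv => /existsPn c0; apply/eqP.
  rewrite [LHS](coord_vbasis (memvf _)); apply: big1 => i _.
  by have := c0 i; rewrite negbK => /eqP ->; rewrite scale0r.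
exists (lfun_of (linc i)); split=> [s sS|]; rewrite lfun_ofE //.
by have /eqP -> : quotv_pi S s == 0; rewrite ?quotv_pi_eq0 ?linear0.
Qed.

Section Functional.
Variables (P1 P0 : rightMod A) (p1 : rhom P1 P0).
Variables (L : leftMod A) (q : 'Hom(star_mod P1, L)).
Hypothesis q_act : forall a g, q (lact a g) = lact a (q g).
Hypothesis q_onto : limg q = fullv.
Hypothesis q_ker : lker q = limg (star_hom p1).

Definition star_of P (g : rhom P (reg_mod A)) : star_mod P :=
  Subvs (introT (homvP (rhom_lfun g)) (rhomP g)).

Lemma star_lin P (g : star_mod P) x a : val g (ract x a) = (val g x : A) * a.
Proof. by have /homvP -> := valP g. Qed.

(** Both directions of Hom(U, D Tr V) = D coker(Hom(P0, U) -> Hom(P1, U)) rest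
    on the pairing of U and P1^* that sends (u, g) to the map x |-> u g(x). *)
Lemma translate_hom_eq0 U : projective P1 -> projective P0 ->
  extends_along p1 U -> forall h : rhom U (dual_mod L), h = 0 :> 'Hom(U, _).
Proof.
move=> proj1 proj0 ext phi.
pose psi (u : U) (g : star_mod P1) : k := (phi u : 'Hom(L, k^o)) (q g).
have psiDl u v g : psi (u + v) g = psi u g + psi v g.
  by rewrite /psi rhomD add_lfunE.
have psi_suml I (r : seq I) (G : I -> U) g :
    psi (\sum_(i <- r) G i) g = \sum_(i <- r) psi (G i) g.
  by rewrite /psi rhom_sum sum_lfunE.
have psi_sumr I (r : seq I) (G : I -> star_mod P1) u :
    psi u (\sum_(i <- r) G i) = \sum_(i <- r) psi u (G i).
  by rewrite /psi !linear_sum.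
have psi_bal u a g : psi (ract u a) g = psi u (lact a g).
  by rewrite /psi rhomP /= comp_lfunE lactfE q_act.
have psi_im u (g : star_mod P0) : psi u (star_hom p1 g) = 0.
  suff /eqP q0 : q (star_hom p1 g) == 0 by rewrite /psi q0 linear0.
  by rewrite -memv_ker q_ker memv_img ?memvf.
have [n [x [g xg]]] := dual_basis proj1.
have [m [y [c yc]]] := dual_basis proj0.
have starE (d : star_mod P1) :
    d = \sum_j lact (val d (x j) : A) (star_of (g j)).
  apply/val_inj/lfunP=> z; rewrite /= {1}(xg z) linear_sum linear_sum sum_lfunE.
  by apply: eq_bigr => j _; rewrite /= comp_lfunE lmulE star_lin.
(* The map x |-> u d(x) is h p1 for some h. Expanding h in the dual basis of P0
   writes psi u d as a sum of terms psi _ (c i o p1), which lie in the image of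
   p1^*. *)
have psi0 u (d : star_mod P1) : psi u d = 0.
  have [f fE] : exists f : rhom P1 U, forall z, f z = ract u (val d z).
    apply: rhom_ext => [l z z' | z a]; first by rewrite linearP linearP.
    by rewrite star_lin ractM.
  have [h hE] := ext f.
  rewrite (starE d) psi_sumr.
  have dE j : psi u (lact (val d (x j) : A) (star_of (g j))) =
      \sum_i psi (h (y i)) (lact (c i (p1 (x j)) : A) (star_of (g j))).
    rewrite -psi_bal -fE -hE {1}(yc (p1 (x j))) rhom_sum psi_suml.
    by apply: eq_bigr => i _; rewrite rhomP psi_bal.
  rewrite (eq_bigr _ (fun j _ => dE j)) exchange_big big1 //= => i _.
  rewrite -psi_sumr -[RHS](psi_im (h (y i)) (star_of (c i))); congr (psi _ _).
  rewrite [RHS]starE; apply: eq_bigr => j _.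
  by rewrite star_homE comp_lfunE.
apply/lfunP=> u; rewrite zero_lfunE; apply/lfunP=> l; rewrite zero_lfunE.
have : l \in limg q by rewrite q_onto memvf.
by case/memv_imgP=> d _ ->; exact: psi0.
Qed.

(** If f : P1 -> U does not extend, a functional on Hom(P1, U) vanishing on the
    extendable maps but not on f gives, through the pairing, a nonzero map
    U -> D Tr V. *)
Lemma extends_of_translate_hom_eq0 U : projective P1 ->
  (forall h : rhom U (dual_mod L), h = 0 :> 'Hom(U, _)) -> extends_along p1 U.
Proof.
move=> proj1 hom0 f.
have lin_pre : linear (fun h : 'Hom(P0, U) => (h \o p1)%VF).
  by move=> l u v; rewrite comp_lfunDl comp_lfunZl.
pose S := (lfun_of lin_pre @: homv P0 U)%VS.
have [fS|fS] := boolP ((f : 'Hom(P1, U)) \in S).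
  case/memv_imgP: fS => h /homvP hP fE; exists (RHom hP) => x.
  by rewrite fE lfun_ofE comp_lfunE.
have [lam [lamS lamf]] := separating_functional fS.
pose m (u : U) (g : star_mod P1) : 'Hom(P1, U) :=
  (linfun (@ract _ _ U u) \o val g)%VF.
have mE u g x : m u g x = ract u (val g x) by rewrite comp_lfunE lfunE.
have m_lin1 g : linear (m^~ g).
  move=> l u v; apply/lfunP=> x; rewrite [LHS]mE add_lfunE scale_lfunE !mE.
  by rewrite ractDl ractZl.
have m_lin2 u : linear (m u).
  move=> l g h; apply/lfunP=> x; rewrite add_lfunE scale_lfunE !mE /=.
  by rewrite add_lfunE scale_lfunE ractDr ractZr.
have m_ker u g : q g = 0 -> lam (m u g) = 0.
  move=> /eqP; rewrite -memv_ker q_ker => /memv_imgP[d _ ->].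
  apply: lamS; apply/memv_imgP.
  have [e eE] : exists e : rhom P0 U, forall y, e y = ract u (val d y).
    apply: rhom_ext => [l z z' | z a]; first by rewrite linearP linearP.
    by rewrite star_lin ractM.
  exists (e : 'Hom(_, _)); first by apply/homvP; exact: rhomP.
  apply/lfunP=> x; rewrite mE lfun_ofE star_homE !comp_lfunE.
  by rewrite eE.
pose s := (q^-1)%VF.
have sK l : q (s l) = l by rewrite limg_lfunVK // q_onto memvf.
have m_eq u g h : q g = q h -> lam (m u g) = lam (m u h).
  move=> qgh; apply/eqP; rewrite -subr_eq0 -linearB /=.
  have -> : m u g - m u h = m u (g - h).
    have := m_lin2 u (-1) h g; rewrite !scaleN1r addrC => <-.
    by rewrite addrC.
  apply/eqP/m_ker; have -> : q (g - h) = q g - q h by exact: linearB.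
  by rewrite qgh subrr.
have lin_l u : linear (fun l => lam (m u (s l))).
  by move=> l x y; rewrite linearP m_lin2 linearP.
pose Phi (u : U) : dual_mod L := lfun_of (lin_l u).
have PhiE u l : (Phi u : 'Hom(L, k^o)) l = lam (m u (s l)) by exact: lfun_ofE.
have [phi phiE] : exists phi : rhom U (dual_mod L), forall u, phi u = Phi u.
  apply: rhom_ext => [l u v | u a]; apply/lfunP=> x.
    by rewrite add_lfunE scale_lfunE !PhiE m_lin1 linearP.
  rewrite /= comp_lfunE lactfE !PhiE.
  have -> : m (ract u a) (s x) = m u (lact a (s x)).
    by apply/lfunP=> z; rewrite !mE /= comp_lfunE lmulE ractM.
  by apply: m_eq; rewrite q_act !sK.
have lam0 u g : lam (m u g) = 0.
  rewrite -(m_eq u (s (q g))) ?sK // -PhiE -phiE.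
  by rewrite (hom0 phi) zero_lfunE zero_lfunE.
have [n [x [g xg]]] := dual_basis proj1.
suff lam_f : lam f = 0 by rewrite lam_f eqxx in lamf.
have -> : (f : 'Hom(P1, U)) = \sum_j m (f (x j)) (star_of (g j)).
  apply/lfunP=> z; rewrite sum_lfunE {1}(xg z) rhom_sum.
  by apply: eq_bigr => j _; rewrite mE rhomP.
by rewrite linear_sum big1 // => j _; exact: lam0.
Qed.
End Functional.

Lemma transpose_ex P1 P0 (p1 : rhom P1 P0) :
  exists (L : leftMod A) (q : 'Hom(star_mod P1, L)),
    [/\ forall a g, q (lact a g) = lact a (q g), limg q = fullv
      & lker q = limg (star_hom p1)].
Proof.
pose N := limg (star_hom p1); pose Q := quotv N.
have NP a g : g \in N -> lact a g \in N.
  case/memv_imgP=> d _ ->; suff -> : lact a (star_hom p1 d) =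
      star_hom p1 (lact a d) by rewrite memv_img ?memvf.
  by apply/val_inj; rewrite star_homE /= star_homE comp_lfunA.
pose act a (z : Q) : Q := quotv_pi N (lact a (vsval z)).
have actE a g : act a (quotv_pi N g) = quotv_pi N (lact a g).
  apply/eqP; rewrite quotv_pi_eq.
  have -> : lact a (vsval (quotv_pi N g)) - lact a g =
      lact a (vsval (quotv_pi N g) - g).
    have := lact_linr a (-1) g (vsval (quotv_pi N g)).
    by rewrite !scaleN1r ![- _ + _]addrC.
  by apply: NP; rewrite -opprB memvN quotv_pi_sub.
have piK (z : Q) : exists g, z = quotv_pi N g.
  by exists (vsval z); rewrite quotv_piK.
have lin1 (z : Q) : linear (act^~ z).
  by move=> l a b; rewrite /act lact_linl linearP.
have lin2 a : linear (act a).
  move=> l u v; rewrite /act.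
  have -> : vsval (l *: u + v) = l *: vsval u + vsval v by [].
  by rewrite lact_linr linearP.
have act1 (z : Q) : act 1 z = z by rewrite /act lact1 quotv_piK.
have actM a b (z : Q) : act (a * b) z = act a (act b z).
  by have [g ->] := piK z; rewrite !actE lactM.
exists (LeftMod lin1 lin2 act1 actM), (quotv_pi N); split=> [a g | | ].
- by rewrite -actE.
- apply/vspaceP=> z; rewrite memvf; have [g ->] := piK z.
  by rewrite memv_img ?memvf.
- by apply/vspaceP=> g; rewrite memv_ker quotv_pi_eq0.
Qed.

(** Relative projectivity of V against surjections with kernel in Fac U; this
    is Ext^1(V, Fac U) = 0. *)
Definition lifts_mod_Fac V U :=
  forall E F (pi : rhom E F) n (g : rhom (pow_mod U n) E) (t : rhom V F),
    limg g = lker pi -> (forall v, t v \in limg pi) ->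
    exists s : rhom V E, forall v, pi (s v) = t v.

(** The special case in which the target is V itself; for U = V it already
    implies tau-rigidity. *)
Definition splits_mod_Fac V U :=
  forall E (pi : rhom E V) n (g : rhom (pow_mod U n) E),
    surjective_hom pi -> limg g = lker pi ->
    exists s : rhom V E, forall v, pi (s v) = v.

(** Lift t p0 to t0 : P0 -> E. Then t0 p1 lands in ker pi, so it factors through
    a power of U and there extends along p1; subtracting the extension from t0
    gives a map that factors through p0. *)
Lemma lifts_of_extends V U P1 P0 (p1 : rhom P1 P0) (p0 : rhom P0 V) :
  min_proj_pres p1 p0 -> extends_along p1 U -> lifts_mod_Fac V U.
Proof.
case=> proj1 proj0 [onto0 exact0] _ _ ext E F pi n g t gE tpi.
have [t0 t0E] : exists t0 : rhom P0 E, forall x, pi (t0 x) = comp_rhom t p0 x.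
  by apply: projective_lift => // x; rewrite comp_rhomE.
have p01 x : p0 (p1 x) = 0 by apply/eqP; rewrite -memv_ker -exact0 limg_mem.
have [r rE] : exists r : rhom P1 (pow_mod U n), forall x,
    g (r x) = comp_rhom t0 p1 x.
  apply: projective_lift => // x.
  by rewrite gE memv_ker comp_rhomE t0E comp_rhomE p01 rhom0.
have [h hE] : exists h : 'I_n -> rhom P0 U, forall j x, h j (p1 x) = r x j.
  have: forall j, exists h : rhom P0 U, forall x, h (p1 x) = r x j.
    move=> j; have [c cE] := @pow_proj_ex _ _ U n j.
    have [h hE] := ext (comp_rhom c r); exists h => x.
    by rewrite hE comp_rhomE cE.
  exact: fin_all_exists.
have [r' r'E] := pow_pair_ex h.
pose t1 := sub_rhom t0 (comp_rhom g r').
have t1E x : t1 x = t0 x - g (r' x) by rewrite sub_rhomE comp_rhomE.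
have [s sE] : exists s : rhom V E, forall x, s (p0 x) = t1 x.
  apply: factor_surj => // x /eqP; rewrite -memv_ker -exact0.
  case/memv_imgP=> z _ ->; rewrite t1E.
  have -> : r' (p1 z) = r z by apply/ffunP=> j; rewrite r'E hE.
  by rewrite rE comp_rhomE subrr.
exists s => v; have [x <-] := (surj_homP p0).1 onto0 v.
rewrite sE t1E rhomB t0E comp_rhomE.
have /eqP -> : pi (g (r' x)) == 0 by rewrite -memv_ker -gE limg_mem.
by rewrite subr0.
Qed.

Lemma quot_mod_ex X (N : {vspace X}) : is_submod N ->
  exists (Q : rightMod A) (p : rhom X Q), surjective_hom p /\ lker p = N.
Proof.
move=> NP; exists (quot_mod NP).
have [p pE] : exists p : rhom X (quot_mod NP), forall x, p x = quotv_pi N x.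
  apply: rhom_ext => [|x a]; first exact: linearP.
  by rewrite /= quot_ract.
exists p; split; last by apply/vspaceP=> x; rewrite memv_ker pE quotv_pi_eq0.
by apply/surj_homP => z; exists (vsval (z : quotv N)); rewrite pE quotv_piK.
Qed.

(** Given g : P1 -> U, form the pushout E of g and p1. It maps onto V with
    kernel the image of U, so it splits, which extends g along p1 up to a map
    into g (ker p1). As ker p1 is superfluous the error term is zero. *)
Lemma extends_of_splits V U P1 P0 (p1 : rhom P1 P0) (p0 : rhom P0 V) :
  min_proj_pres p1 p0 -> splits_mod_Fac V U -> extends_along p1 U.
Proof.
case=> proj1 proj0 [onto0 exact0] _ sup1 split g.
have p01 x : p0 (p1 x) = 0 by apply/eqP; rewrite -memv_ker -exact0 limg_mem.
have [c cE] := pair_rhom_ex g (sub_rhom (zero_hom _ _) p1).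
have cE' x : c x = (g x, - p1 x) by rewrite cE sub_rhomE zero_rhomE sub0r.
have [E [w [w_onto w_ker]]] := quot_mod_ex (limg_is_submod c).
have wP z : (w z = 0) <-> (exists x, z = c x).
  split=> [/eqP | [x ->]]; last by apply/eqP; rewrite -memv_ker w_ker limg_mem.
  by rewrite -memv_ker w_ker => /memv_imgP[x _ ->]; exists x.
have [jU jUE] := inl_rhom_ex U P0; have [jP jPE] := inr_rhom_ex U P0.
have [q2 q2E] := snd_rhom_ex U P0.
have [pi piE] : exists pi : rhom E V, forall z, pi (w z) = comp_rhom p0 q2 z.
  apply: factor_surj => // z /wP[x ->].
  by rewrite comp_rhomE q2E cE' /= rhomN p01 oppr0.
have [pr prE] := @pow_proj_ex _ _ U 1 ord0.
pose gU := comp_rhom w (comp_rhom jU pr).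
have gUE x : gU x = w (x ord0, 0) by rewrite !comp_rhomE prE jUE.
have sumE (u : U) (y : P0) : w (u, y) = w (u, 0) + w (0, y).
  by rewrite -rhomD; congr (w (_, _)); rewrite /= ?addr0 ?add0r.
have w10 u : exists a, gU a = w (u, 0).
  by exists [ffun=> u]; rewrite gUE ffunE.
have im_gU : limg gU = lker pi.
  apply/vspaceP=> e; apply/memv_imgP/idP => [[x _ ->] | ].
    by rewrite memv_ker gUE piE comp_rhomE q2E rhom0.
  rewrite memv_ker; have [[u y] <-] := (surj_homP w).1 w_onto e.
  rewrite piE comp_rhomE q2E /= -memv_ker -exact0 => /memv_imgP[x _ ->].
  have [a aE] := w10 (u + g x); exists a; rewrite ?memvf // aE.
  suff : w ((u, p1 x) - (u + g x, 0)) = 0.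
    by rewrite rhomB => /eqP; rewrite subr_eq0 => /eqP.
  apply/wP; exists (- x); rewrite cE' !rhomN opprK.
  by congr (_, _) => /=; rewrite ?subr0 // opprD addNKr.
have [|s sE] := split _ pi _ gU _ im_gU.
  apply/surj_homP => v; have [y <-] := (surj_homP p0).1 onto0 v.
  by exists (w (0, y)); rewrite piE comp_rhomE q2E.
pose d := sub_rhom (comp_rhom w jP) (comp_rhom s p0).
have dE y : d y = w (0, y) - s (p0 y) by rewrite sub_rhomE !comp_rhomE jPE.
have [h hE] : exists h : rhom P0 (pow_mod U 1), forall y, gU (h y) = d y.
  apply: projective_lift => // y.
  rewrite im_gU memv_ker dE rhomB sE piE comp_rhomE q2E /=.
  by rewrite subrr.
pose h0 := comp_rhom pr h.
have h0E y : w (h0 y, 0) = w (0, y) - s (p0 y).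
  by rewrite comp_rhomE prE -gUE hE dE.
pose g' := sub_rhom g (comp_rhom h0 p1).
have g'E x : g' x = g x - h0 (p1 x) by rewrite sub_rhomE comp_rhomE.
(* On ker p1 the maps g' and g agree, and g' x is in g (ker p1) for every x. *)
have err x : exists2 z, p1 z = 0 & g' x = g' z.
  have /wP[z] : w (h0 (p1 x) - g x, 0) = 0.
    have -> : (h0 (p1 x) - g x, 0) = (h0 (p1 x), 0) - c x + (0, - p1 x)
        :> sum_mod U P0.
      rewrite cE'; congr (_, _) => /=; rewrite ?addr0 ?sub0r //.
      by rewrite opprK subrr.
    have wc : w (c x) = 0 by apply/wP; exists x.
    rewrite rhomD rhomB wc subr0 h0E p01 rhom0 subr0 -rhomD -[RHS](rhom0 w).
    by congr (w (_, _)); rewrite /= ?addr0 ?subrr.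
  rewrite cE' => -[e1 /eqP]; rewrite eq_sym oppr_eq0 => /eqP e2.
  exists (- z); first by rewrite rhomN e2 oppr0.
  rewrite !g'E !rhomN e2 rhom0 oppr0 subr0.
  by rewrite -e1 opprB.
have : lker g' = fullv.
  apply: sup1; first exact: lker_is_submod.
  apply/vspaceP=> x; rewrite memvf; have [z z0 xz] := err x.
  rewrite -(subrK z x) addrC; apply: memv_add; rewrite memv_ker.
    by rewrite z0.
  by rewrite rhomB xz subrr.
move=> ker; exists h0 => x; apply/eqP; rewrite eq_sym -subr_eq0 -g'E.
by rewrite -memv_ker ker memvf.
Qed.

(** The Auslander-Smalo criterion, Hom(V, tau V) = 0 if and only if
    Ext^1(V, Fac V) = 0, in two halves. *)
Lemma tau_rigid_lifts V : tau_rigid V -> lifts_mod_Fac V V.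
Proof.
move=> [T [[L [[P1 [P0 [p1 [p0 [pres [q [q_act q_onto q_ker]]]]]]] ->]] hom0]].
have [proj1 _ _ _ _] := pres.
by apply: lifts_of_extends pres (extends_of_translate_hom_eq0 q_act _ _ _ _).
Qed.

Lemma splits_tau_rigid V : splits_mod_Fac V V -> tau_rigid V.
Proof.
move=> split; have [P1 [P0 [p1 [p0 pres]]]] := min_proj_pres_ex V.
have [L [q [q_act q_onto q_ker]]] := transpose_ex p1.
have [proj1 proj0 _ _ _] := pres.
exists (dual_mod L); split.
  exists L; split=> //; exists P1, P0, p1, p0; split=> //.
  by exists q.
apply: (translate_hom_eq0 q_act q_onto q_ker) => //.
exact: extends_of_splits pres split.
Qed.

End Translate.

(** * Modules generated by a module *)

Section Generated.
Variables (k : fieldType) (A : fdAlgType k).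
Implicit Types X U E F : rightMod A.

(** Sums of elements h u, for h : U -> E with values in N. Being closed under
    sums and images this is easier to propagate than the existence of one map
    out of a power of U, to which it amounts when N consists of such sums. *)
Inductive generated U E (N : {vspace E}) : E -> Prop :=
| generated0 : generated U N 0
| generatedD (h : rhom U E) u x : (forall v, h v \in N) ->
    generated U N x -> generated U N (h u + x).

Lemma generated_add U E (N : {vspace E}) x y :
  generated U N x -> generated U N y -> generated U N (x + y).
Proof.
move=> Gx Gy; elim: Gx => [|h u z hN _ IHz]; first by rewrite add0r.
by rewrite -addrA; exact: generatedD.
Qed.

Lemma generated_hom U E (N : {vspace E}) (h : rhom U E) u :
  (forall v, h v \in N) -> generated U N (h u).
Proof.
by move=> hN; rewrite -[h u]addr0; apply: generatedD => //; exact: generated0.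
Qed.

Lemma generated_map U E F (N : {vspace E}) (N' : {vspace F}) (h : rhom E F) x :
  (forall v, h v \in N') -> generated U N x -> generated U N' (h x).
Proof.
move=> hN'; elim=> [|g u z _ _ IHz]; first by rewrite rhom0; exact: generated0.
rewrite rhomD -comp_rhomE; apply: generatedD => // v.
by rewrite comp_rhomE.
Qed.

Lemma generated_sub U E (N N' : {vspace E}) x :
  (N <= N')%VS -> generated U N x -> generated U N' x.
Proof.
move=> /subvP NN'; elim=> [|h u z hN _ IHz]; first exact: generated0.
by apply: generatedD => // v; exact/NN'/hN.
Qed.

Lemma generated_limg U E n (g : rhom (pow_mod U n) E) x :
  x \in limg g -> generated U (limg g) x.
Proof.
case/memv_imgP=> c _ ->.
have [i iE] : exists i : 'I_n -> rhom U (pow_mod U n), forall j u l,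
    i j u l = if l == j then u else 0.
  have: forall j : 'I_n, exists i : rhom U (pow_mod U n), forall u l,
    i u l = if l == j then u else 0 by move=> j; exact: pow_inj_ex.
  exact: fin_all_exists.
have -> : c = \sum_j i j (c j).
  apply/ffunP=> l; rewrite sum_ffunE (bigD1 l) //= iE eqxx big1 ?addr0 //.
  by move=> j /negPf jl; rewrite iE eq_sym jl.
rewrite rhom_sum; apply: (big_ind (generated U (limg g))).
- exact: generated0.
- exact: generated_add.
move=> j _; rewrite -comp_rhomE; apply: generated_hom => v.
by rewrite comp_rhomE limg_mem.
Qed.

Lemma generated_pow U E (N : {vspace E}) :
  (forall x, x \in N -> generated U N x) ->
  exists n (g : rhom (pow_mod U n) E), limg g = N.
Proof.
move=> genN.
(* A map with image of largest dimension inside N has image N. *)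
pose OK (p : {n : nat & rhom (pow_mod U n) E}) := (limg (tagged p) <= N)%VS.
have [|[n g] [gN gmax]] :=
  @exists_minimum _ OK (fun p => \dim N - \dim (limg (tagged p)))%N.
  exists (Tagged (fun n => rhom (pow_mod U n) E) (zero_hom (pow_mod U 0) E)).
  by apply/subvP=> _ /memv_imgP[x _ ->]; rewrite zero_rhomE mem0v.
rewrite /OK /= in gN; exists n, g; apply/eqP; rewrite eqEsubv gN /=; apply/subvP => x /genN.
elim=> [|h u z hN _ IHz]; [exact: mem0v | apply: memvD IHz].
have [pr prE] : exists pr : 'I_n -> rhom (pow_mod U n.+1) U,
    forall j c, pr j c = c (lift ord0 j).
  have: forall j : 'I_n, exists pr : rhom (pow_mod U n.+1) U,
    forall c, pr c = c (lift ord0 j) by move=> j; exact: pow_proj_ex.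
  exact: fin_all_exists.
have [sh shE] := pow_pair_ex pr; have [p0 p0E] := @pow_proj_ex _ _ U n.+1 ord0.
pose g' := add_rhom (comp_rhom g sh) (comp_rhom h p0).
have g'E c : g' c = g (sh c) + h (c ord0).
  by rewrite add_rhomE !comp_rhomE p0E.
have g'N : (limg g' <= N)%VS.
  apply/subvP=> _ /memv_imgP[c _ ->]; rewrite g'E memvD //.
  by apply: (subvP gN); exact: limg_mem.
have gg' : (limg g <= limg g')%VS.
  apply/subvP=> _ /memv_imgP[c _ ->]; apply/memv_imgP.
  pose c' : {ffun 'I_n.+1 -> U} :=
    [ffun i => if unlift ord0 i is Some j then c j else 0].
  exists (c' : pow_mod U n.+1); rewrite ?memvf // g'E.
  have -> : c' ord0 = 0 by rewrite ffunE unlift_none.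
  rewrite rhom0 addr0; congr (g _); apply/ffunP=> j.
  by rewrite shE prE ffunE liftK.
have -> : limg g = limg g'.
  apply/eqP; rewrite eqEdim gg' /=.
  have := gmax (Tagged (fun n => rhom (pow_mod U n) E) g') g'N.
  by have := dimvS g'N; have := dimvS gN; rewrite /=; lia.
apply/memv_imgP; pose c' : {ffun 'I_n.+1 -> U} :=
  [ffun i => if i == ord0 then u else 0].
exists (c' : pow_mod U n.+1); rewrite ?memvf // g'E.
have -> : c' ord0 = u by rewrite ffunE eqxx.
have -> : sh c' = 0 by apply/ffunP=> j; rewrite shE prE !ffunE.
by rewrite rhom0 add0r.
Qed.

Lemma Fac_generated X U (u : U) : Fac X U -> generated X fullv u.
Proof.
case=> n [g g_onto]; have : u \in limg g by rewrite g_onto memvf.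
by move/generated_limg; apply: generated_sub; exact: subvf.
Qed.

Lemma generated_Fac X U : (forall u : U, generated X fullv u) -> Fac X U.
Proof. by move=> gen; apply: generated_pow => u _; exact: gen. Qed.

End Generated.

(** * Modules over a quotient algebra *)

Section Descend.
Variables (k : fieldType) (A : fdAlgType k) (e : A).
Implicit Types X E F : rightMod A.

Lemma annihilates_of_idem X : (forall x : X, ract x e = 0) -> annihilates e X.
Proof.
move=> Xe x a aI; have -> : ract x a = linfun (@ract _ _ X x) a by rewrite lfunE.
apply/eqP; rewrite -memv_ker; apply: (subvP _ _ aI).
apply/span_subvP => _ /allpairsP[p [_ _ ->]].
by rewrite memv_ker lfunE /= !ractM Xe ract0l.
Qed.

Lemma descend_act X (XI : annihilates e X) (x : X) a :
  ract (x : descend XI) (quotAlg_pi e a) = ract x a.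
Proof. exact: (annihilates_pi XI x a). Qed.

Lemma quotAlg_pi_onto (q : quotAlg e) : exists a, q = quotAlg_pi e a.
Proof. by exists (vsval q); rewrite quotAlg_piK. Qed.

Lemma descend_hom_ex E F (EI : annihilates e E) (FI : annihilates e F)
    (h : rhom E F) :
  exists g : rhom (descend EI) (descend FI), forall x, g x = h x.
Proof.
apply: rhom_ext => [|x q]; first exact: linearP.
exact: (rhomP h).
Qed.

Lemma ascend_hom_ex E F (EI : annihilates e E) (FI : annihilates e F)
    (h : rhom (descend EI) (descend FI)) :
  exists g : rhom E F, forall x, g x = h x.
Proof.
apply: rhom_ext => [|x a]; first exact: linearP.
by rewrite -(descend_act EI) rhomP descend_act.
Qed.

Lemma annihilates_Fac X U : annihilates e X -> Fac X U -> annihilates e U.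
Proof.
move=> XI FU u a aI; elim: (Fac_generated u FU) => [|h x z _ _ IHz].
  exact: ract0l.
by rewrite ractDl IHz addr0 -rhomP XI // rhom0.
Qed.

(** The lifting property of a tau-rigid A/<e>-module, stated over A because
    tensor products and Fac X refer to A-modules. *)
Lemma descend_lifts X E F (XI : annihilates e X) (EI : annihilates e E)
    (FI : annihilates e F) (pi : rhom E F) (t : rhom X F) :
  tau_rigid (descend XI) ->
  (forall x, pi x = 0 -> generated X (lker pi) x) ->
  (forall v, t v \in limg pi) ->
  exists s : rhom X E, forall v, pi (s v) = t v.
Proof.
move=> rigX genK tpi; have [pi' pi'E] := descend_hom_ex EI FI pi.
have [t' t'E] := descend_hom_ex XI FI t.
have [n [g gE]] : exists n (g : rhom (pow_mod (descend XI) n) (descend EI)),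
    limg g = lker pi'.
  apply: generated_pow => x; rewrite memv_ker pi'E => /eqP/genK.
  elim=> [|h u z hK _ IHz]; first exact: generated0.
  have [h' h'E] := descend_hom_ex XI EI h.
  rewrite -h'E; apply: generatedD => // v.
  by rewrite memv_ker h'E pi'E -memv_ker hK.
have [|s sE] := tau_rigid_lifts rigX gE (t := t').
  by move=> v; rewrite t'E; have /memv_imgP[x _ ->] := tpi v; rewrite -pi'E limg_mem.
have [s' s'E] := ascend_hom_ex s; exists s' => v.
by rewrite s'E -pi'E sE t'E.
Qed.

End Descend.

(** * Tensor products and corners of algebras *)

Section TensorHom.
Variables (k : fieldType) (C B : fdAlgType k) (Y : rightMod C) (M : bimod C B).

Lemma tensor_ext (V : vectType k) (h h' : 'Hom(tensor_mod Y M, V)) :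
  (forall y m, h (tensor y m) = h' (tensor y m)) -> h = h'.
Proof.
move=> hh'.
have [|||g [_ uniq]] := @tensor_universal k C B Y M V (fun y m => h (tensor y m)).
- by move=> m l y y'; rewrite tensor_linl linearP.
- by move=> y l m m'; rewrite tensor_linr linearP.
- by move=> y c m; rewrite tensor_balanced.
by rewrite -(uniq h) // -(uniq h').
Qed.

Lemma tensor_hom_ex (E : rightMod B) (g : Y -> M -> E) :
  (forall m, linear (g^~ m)) -> (forall y, linear (g y)) ->
  (forall y c m, g (ract y c) m = g y (blact c m)) ->
  (forall y m b, g y (ract m b) = ract (g y m) b) ->
  exists h : rhom (tensor_mod Y M) E, forall y m, h (tensor y m) = g y m.
Proof.
move=> gl gr gb ga; have [h [hE _]] := tensor_universal gl gr gb.
suff hP t b : h (ract t b) = ract (h t) b by exists (RHom hP).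
have linL : linear (fun t : tensor_mod Y M => h (ract t b)).
  by move=> l u v; rewrite ract_linl linearP.
have linR : linear (fun t : tensor_mod Y M => ract (h t) b).
  by move=> l u v; rewrite linearP ract_linl.
rewrite -(lfun_ofE linL) -(lfun_ofE linR); congr (fun_of_lfun _ _).
apply: tensor_ext => y m.
by rewrite !lfun_ofE tensor_ract !hE ga.
Qed.

End TensorHom.

Lemma quotAlg_map_ex (k : fieldType) (A B : fdAlgType k) (e : B) (d : A)
    (theta : 'Hom(B, A)) :
  (forall a b, theta (a * b) = theta a * theta b) -> theta e \in ideal d ->
  exists th : 'Hom(quotAlg e, quotAlg d),
    (forall a b, th (a * b) = th a * th b) /\
    (forall b, th (quotAlg_pi e b) = quotAlg_pi d (theta b)).
Proof.
move=> thM the.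
have thI b : b \in ideal e -> theta b \in ideal d.
  suff: (ideal e <= theta @^-1: ideal d)%VS.
    by move/subvP=> H /H; rewrite memv_preim.
  apply: ideal_min => [|a x|x a]; rewrite -!memv_preim // thM.
    exact: ideal_mull.
  exact: ideal_mulr.
have lin_th : linear (fun q : quotAlg e => quotAlg_pi d (theta (vsval q))).
  move=> l u v; have -> : vsval (l *: u + v) = l *: vsval u + vsval v by [].
  by rewrite !linearP.
pose th := lfun_of lin_th.
have thE b : th (quotAlg_pi e b) = quotAlg_pi d (theta b).
  rewrite lfun_ofE; apply/eqP; rewrite quotv_pi_eq -linearB.
  by apply: thI; rewrite -opprB memvN quotv_pi_sub.
exists th; split=> // a b.
have [a' ->] := quotAlg_pi_onto a; have [b' ->] := quotAlg_pi_onto b.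
by rewrite -quotAlg_piM !thE thM quotAlg_piM.
Qed.

Section Peirce.
Variables (k : fieldType) (A : fdAlgType k).

(** P is the projective right module a A. *)
Definition is_peirce (a : A) (P : rightMod A) (i : rhom P (reg_mod A)) :=
  injective i /\ forall x : A, (exists s, i s = x) <-> a * x = x.

Lemma peirce_ex (a : A) : a * a = a -> exists P i, @is_peirce a P i.
Proof.
move=> aa; pose N : {vspace reg_mod A} := limg (lmul a).
have NP : is_submod N.
  by move=> _ b /memv_imgP[x _ ->]; rewrite /= lmulE -mulrA -lmulE memv_img ?memvf.
have [P [i [inj_i im_i _]]] := submod_ex NP; exists P, i; split=> // x.
split=> [[s <-] | ax].
  have : i s \in N by rewrite -im_i limg_mem.
  by case/memv_imgP=> y _ ->; rewrite lmulE mulrA aa.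
have : x \in N by rewrite -ax -lmulE memv_img ?memvf.
by rewrite -im_i => /memv_imgP[s _ ->]; exists s.
Qed.

Lemma peirce_iso (a b : A) P Q (i : rhom P (reg_mod A)) (j : rhom Q (reg_mod A)) :
  is_peirce a i -> is_peirce b j -> a + b = 1 -> a * b = 0 -> b * a = 0 ->
  iso_mod (sum_mod P Q) (reg_mod A).
Proof.
move=> [inj_i iP] [inj_j jP] ab1 ab0 ba0.
have ai s : a * i s = i s by apply/iP; exists s.
have bj s : b * j s = j s by apply/jP; exists s.
have [p pE] := fst_rhom_ex P Q; have [q qE] := snd_rhom_ex P Q.
pose f := add_rhom (comp_rhom i p) (comp_rhom j q).
have fE z : f z = i z.1 + j z.2 by rewrite add_rhomE !comp_rhomE pE qE.
exists f; apply/bijective_rhom; split.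
  apply/eqP; rewrite -subv0; apply/subvP=> -[s t].
  rewrite memv_ker fE /= => /eqP f0.
  have is0 : i s = 0.
    rewrite -[i s]ai -[a * _]addr0 -[X in _ + X](mul0r (j t)) -ab0 -mulrA bj.
    by rewrite -mulrDr f0 mulr0.
  have jt0 : j t = 0 by move: f0; rewrite is0 add0r.
  rewrite memv0; apply/eqP; congr (_, _).
    by apply: inj_i; rewrite is0 rhom0.
  by apply: inj_j; rewrite jt0 rhom0.
have aa : a * a = a by rewrite -[RHS]mulr1 -ab1 mulrDr ab0 addr0.
have bb : b * b = b by rewrite -[RHS]mulr1 -ab1 mulrDr ba0 add0r.
apply/surj_homP => x.
have [s sE] := (iP (a * x)).2 (ltac:(by rewrite mulrA aa)).
have [t tE] := (jP (b * x)).2 (ltac:(by rewrite mulrA bb)).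
by exists (s, t); rewrite fE /= sE tE -mulrDl ab1 mul1r.
Qed.

(** A homomorphism out of a A, a = theta 1, is determined by its value at a. *)
Lemma peirce_reflect (B : fdAlgType k) (theta : 'Hom(B, A)) P
    (i : rhom P (reg_mod A)) (h : rhom P P) :
  is_peirce (theta 1) i -> theta 1 * theta 1 = theta 1 ->
  (forall z, ract z (theta 1) = z -> h z = z) -> bijective h.
Proof.
move=> [inj_i iP] aa hid; have [s sE] := (iP (theta 1)).2 aa.
have hs : h s = s by apply: hid; apply: inj_i; rewrite rhomP sE.
have zE z : z = ract s (i z).
  by apply: inj_i; rewrite rhomP sE; apply/esym/iP; exists z.
by exists id => z; rewrite [z in h z]zE rhomP hs -zE.
Qed.

(** When theta identifies B with the corner a A a, where a = theta 1, an
    endomorphism b of B extends to a A as left multiplication by theta (b 1). *)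
Lemma num_indec_peirce (B : fdAlgType k) (theta : 'Hom(B, A)) P
    (i : rhom P (reg_mod A)) n :
  (forall a b, theta (a * b) = theta a * theta b) -> injective theta ->
  (forall x, theta 1 * x = x -> x * theta 1 = x -> exists b, theta b = x) ->
  is_peirce (theta 1) i -> num_indec (reg_mod B) n -> num_indec P n.
Proof.
move=> thM inj_th th_onto peirceP; have [inj_i iP] := peirceP.
have aa : theta 1 * theta 1 = theta 1 by rewrite -thM mulr1.
have ath b : theta 1 * theta b = theta b by rewrite -thM mul1r.
have [s sE] := (iP (theta 1)).2 aa.
(* phi : B -> a A is the corestriction of theta. *)
have lin_phi : linear (fun b : reg_mod B => ract s (theta b)).
  by move=> l u v; rewrite linearP ractDr ractZr.
have phiE b : i (lfun_of lin_phi b) = theta b by rewrite lfun_ofE rhomP sE; exact: ath.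
apply: (@num_indec_transfer _ A B theta P (reg_mod B) (lfun_of lin_phi)) => //.
- by move=> x y xy; apply: inj_th; rewrite -!phiE xy.
- move=> z zE; have [|| b bE] := th_onto (i z).
  + by apply/iP; exists z.
  + by rewrite -[in RHS]zE rhomP.
  by exists b; apply: inj_i; rewrite phiE.
- by move=> y b; apply: inj_i; rewrite rhomP !phiE; exact: thM.
- move=> b; pose c := theta (b 1).
  have [f fE] : exists f : rhom P (reg_mod A), forall z, f z = c * i z.
    apply: rhom_ext => [l u v | z x].
      by rewrite linearP mulrDr -fdscaleAr.
    by rewrite rhomP /= mulrA.
  have [h hE] : exists h : rhom P P, forall z, i (h z) = f z.
    have [g gE] : exists g : P -> P, forall z, i (g z) = f z.
      exists (fun z => ract s (f z)) => z; rewrite rhomP sE fE.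
      by rewrite /= mulrA ath.
    have [h hE] : exists h : rhom P P, forall z, h z = g z.
      apply: rhom_ext => [l u v | z x]; apply: inj_i.
        by rewrite rhomD rhomZ !gE linearP.
      by rewrite rhomP !gE rhomP.
    by exists h => z; rewrite hE.
  exists h => y; apply: inj_i; rewrite hE fE !phiE -thM; congr (theta _).
  by rewrite -[RHS]/(b y) -[y in RHS]mul1r; exact/esym/(rhomP b).
move=> h hid; apply: (peirce_reflect peirceP aa) => z zE.
have [|| b bE] := th_onto (i z).
- by apply/iP; exists z.
- by rewrite -[in RHS]zE rhomP.
have -> : z = lfun_of lin_phi b by apply: inj_i; rewrite phiE.
by rewrite hid.
Qed.

End Peirce.

(** * Triangular matrix algebras *)

Section Triangular.
Variables (k : fieldType) (B C : fdAlgType k) (M : bimod C B).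
Local Notation A := (triAlg M : fdAlgType k).

Lemma tri_mulE (b b' : B) (m m' : M) (c c' : C) :
  ((b, m, c) : A) * ((b', m', c') : A) =
  ((b * b', ract m b' + blact c m', c * c') : A).
Proof. by []. Qed.

Fact tri_B_linear : linear (fun b : B => ((b, 0, 0) : A)).
Proof.
by move=> l u v; congr (_, _, _) => /=; rewrite ?scaler0 ?addr0.
Qed.
Fact tri_M_linear : linear (fun m : M => ((0, m, 0) : A)).
Proof.
by move=> l u v; congr (_, _, _) => /=; rewrite ?scaler0 ?addr0.
Qed.
Fact tri_C_linear : linear (fun c : C => ((0, 0, c) : A)).
Proof.
by move=> l u v; congr (_, _, _) => /=; rewrite ?scaler0 ?addr0.
Qed.
Definition tri_B : 'Hom(B, A) := lfun_of tri_B_linear.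
Definition tri_M : 'Hom(M, A) := lfun_of tri_M_linear.
Definition tri_C : 'Hom(C, A) := lfun_of tri_C_linear.
Lemma tri_BE b : tri_B b = ((b, 0, 0) : A). Proof. exact: lfun_ofE. Qed.
Lemma tri_ME m : tri_M m = ((0, m, 0) : A). Proof. exact: lfun_ofE. Qed.
Lemma tri_CE c : tri_C c = ((0, 0, c) : A). Proof. exact: lfun_ofE. Qed.

Lemma tri_BM a b : tri_B (a * b) = tri_B a * tri_B b.
Proof. by rewrite !tri_BE tri_mulE ract0l blact0l addr0 mulr0. Qed.
Lemma tri_CM a b : tri_C (a * b) = tri_C a * tri_C b.
Proof. by rewrite !tri_CE tri_mulE ract0l blact0r addr0 mulr0. Qed.
Lemma tri_BC b c : tri_B b * tri_C c = 0.
Proof. by rewrite tri_BE tri_CE tri_mulE ract0l blact0r !(mulr0, mul0r, addr0). Qed.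
Lemma tri_CB b c : tri_C c * tri_B b = 0.
Proof. by rewrite tri_BE tri_CE tri_mulE ract0l blact0r !(mulr0, mul0r, addr0). Qed.
Lemma tri_MB m b : tri_M m * tri_B b = tri_M (ract m b).
Proof. by rewrite tri_BE !tri_ME tri_mulE blact0r !(mulr0, mul0r, addr0). Qed.
Lemma tri_CMM c m : tri_C c * tri_M m = tri_M (blact c m).
Proof. by rewrite tri_CE !tri_ME tri_mulE ract0l !(mulr0, mul0r, add0r). Qed.
Lemma tri_one_decomp : tri_B 1 + tri_C 1 = 1.
Proof.
by rewrite tri_BE tri_CE; congr (_, _, _) => /=; rewrite ?addr0 ?add0r.
Qed.
Lemma tri_Bl (a : A) : tri_B 1 * a = tri_B a.1.1.
Proof.
case: a => [[b m] c]; rewrite !tri_BE !tri_mulE /=.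
by rewrite !(ract0l, ract0r, blact0r, blact0l, mul0r, addr0, mul1r).
Qed.
Lemma tri_Cl (a : A) : tri_C 1 * a = tri_M a.1.2 + tri_C a.2.
Proof.
case: a => [[b m] c]; rewrite !tri_CE tri_ME !tri_mulE /=.
rewrite !(ract0l, ract0r, blact0r, blact0l, mul0r, add0r, mul1r) blact1.
by congr (_, _, _); rewrite /= ?addr0 ?add0r.
Qed.
Lemma tri_Bcorner (a : A) : tri_B 1 * a * tri_B 1 = tri_B a.1.1.
Proof. by rewrite tri_Bl -tri_BM mulr1. Qed.
Lemma tri_Ccorner (a : A) : tri_C 1 * a * tri_C 1 = tri_C a.2.
Proof.
case: a => [[b m] c]; rewrite !tri_CE !tri_mulE /=.
by rewrite !(ract0l, ract0r, blact0r, blact0l, mulr0, mul0r, addr0, add0r, mulr1, mul1r).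
Qed.
Lemma tri_BaC (a : A) : tri_B 1 * a * tri_C 1 = 0.
Proof. by rewrite tri_Bl tri_BC. Qed.

Variables (e : B) (e' : C).
Definition tri_idem : A := (e, 0, e').

Lemma tri_idemE : tri_idem = tri_B e + tri_C e'.
Proof.
by rewrite tri_BE tri_CE; congr (_, _, _) => /=; rewrite ?addr0 ?add0r.
Qed.

Lemma tri_idem_idem : e * e = e -> e' * e' = e' -> tri_idem * tri_idem = tri_idem.
Proof. by move=> ee ee'; rewrite tri_mulE ee ee' ract0l blact0r addr0. Qed.

Lemma ideal_tri_B : tri_B e \in ideal tri_idem.
Proof.
have -> : tri_B e = tri_B 1 * tri_idem.
  by rewrite tri_idemE mulrDr -tri_BM mul1r tri_BC addr0.
by rewrite ideal_mull // ideal_gen.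
Qed.
Lemma ideal_tri_C : tri_C e' \in ideal tri_idem.
Proof.
have -> : tri_C e' = tri_C 1 * tri_idem.
  by rewrite tri_idemE mulrDr -tri_CM mul1r tri_CB add0r.
by rewrite ideal_mull // ideal_gen.
Qed.

Lemma ideal_tri_fst (a : A) : a \in ideal tri_idem -> a.1.1 \in ideal e.
Proof.
have lin : linear (fun a : A => (a.1.1 : B)) by [].
pose U := (lfun_of lin @^-1: ideal e)%VS.
have UE (x : A) : (x \in U) = (x.1.1 \in ideal e) by rewrite -memv_preim lfun_ofE.
rewrite -UE; move: a; apply/subvP; apply: ideal_min => [|a x|x a]; rewrite !UE.
- exact: ideal_gen.
- by case: a x => [[? ?] ?] [[? ?] ?]; exact: ideal_mull.
- by case: a x => [[? ?] ?] [[? ?] ?]; exact: ideal_mulr.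
Qed.
Lemma ideal_tri_snd (a : A) : a \in ideal tri_idem -> a.2 \in ideal e'.
Proof.
have lin : linear (fun a : A => (a.2 : C)) by [].
pose U := (lfun_of lin @^-1: ideal e')%VS.
have UE (x : A) : (x \in U) = (x.2 \in ideal e') by rewrite -memv_preim lfun_ofE.
rewrite -UE; move: a; apply/subvP; apply: ideal_min => [|a x|x a]; rewrite !UE.
- exact: ideal_gen.
- by case: a x => [[? ?] ?] [[? ?] ?]; exact: ideal_mull.
- by case: a x => [[? ?] ?] [[? ?] ?]; exact: ideal_mulr.
Qed.

Lemma quot_tri_B_ex : exists th : 'Hom(quotAlg e, quotAlg tri_idem),
  [/\ forall a b, th (a * b) = th a * th b,
      forall b, th (quotAlg_pi e b) = quotAlg_pi tri_idem (tri_B b)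
    & injective th].
Proof.
have [th [thM thE]] := quotAlg_map_ex tri_BM ideal_tri_B.
exists th; split=> // x y; have [b ->] := quotAlg_pi_onto x.
have [b' ->] := quotAlg_pi_onto y; rewrite !thE => /eqP.
have lB : tri_B (b - b') = tri_B b - tri_B b' by exact: linearB.
rewrite quotv_pi_eq -lB tri_BE => /ideal_tri_fst /= bb'.
by apply/eqP; rewrite quotv_pi_eq.
Qed.
Lemma quot_tri_C_ex : exists th : 'Hom(quotAlg e', quotAlg tri_idem),
  [/\ forall a b, th (a * b) = th a * th b,
      forall b, th (quotAlg_pi e' b) = quotAlg_pi tri_idem (tri_C b)
    & injective th].
Proof.
have [th [thM thE]] := quotAlg_map_ex tri_CM ideal_tri_C.
exists th; split=> // x y; have [b ->] := quotAlg_pi_onto x.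
have [b' ->] := quotAlg_pi_onto y; rewrite !thE => /eqP.
have lB : tri_C (b - b') = tri_C b - tri_C b' by exact: linearB.
rewrite quotv_pi_eq -lB tri_CE => /ideal_tri_snd /= bb'.
by apply/eqP; rewrite quotv_pi_eq.
Qed.

(** A/<(e, 0, e')> is the sum of two projectives whose corners are B/<e> and
    C/<e'>, so its count is the sum of theirs. *)
Lemma num_indec_tri_quot m n :
  num_indec (reg_mod (quotAlg e)) m -> num_indec (reg_mod (quotAlg e')) n ->
  num_indec (reg_mod (quotAlg tri_idem)) (m + n).
Proof.
move=> numB numC; pose pi := quotAlg_pi tri_idem.
have [thB [thBM thBE thB_inj]] := quot_tri_B_ex.
have [thC [thCM thCE thC_inj]] := quot_tri_C_ex.
have B1 : thB 1 = pi (tri_B 1) by rewrite -thBE.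
have C1 : thC 1 = pi (tri_C 1) by rewrite -thCE.
have aa : thB 1 * thB 1 = thB 1 by rewrite -thBM mulr1.
have bb : thC 1 * thC 1 = thC 1 by rewrite -thCM mulr1.
have [P [i peirceP]] := peirce_ex aa; have [Q [j peirceQ]] := peirce_ex bb.
have iso := peirce_iso peirceP peirceQ _ _ _.
have {}iso : iso_mod (sum_mod P Q) (reg_mod (quotAlg tri_idem)).
  apply: iso; rewrite B1 C1.
  - by rewrite -linearD tri_one_decomp.
  - by rewrite -quotAlg_piM tri_BC linear0.
  - by rewrite -quotAlg_piM tri_CB linear0.
apply: (num_indec_iso iso); apply: num_indec_sum => [T indT TP TQ | | ].
- have [[t t0] _] := (indecomposableP T).1 indT; apply: t0.
  suff T0 : is_zero_mod T by exact: T0.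
  have refl (h : rhom Q Q) : (forall z, ract z (thC 1) = z -> h z = z) ->
    bijective h by exact: (peirce_reflect peirceQ bb).
  apply: (retract_corner_neq0 refl TQ) => {}t.
  case: TP => [u [p pK]]; rewrite -(pK t) -rhomP.
  suff -> : ract (u t) (thC 1) = 0 by rewrite rhom0.
  have [inj_i iP] := peirceP; apply: inj_i; rewrite rhomP rhom0.
  have <- : thB 1 * i (u t) = i (u t) by apply/iP; exists (u t).
  have [a ->] := quotAlg_pi_onto (i (u t)).
  by rewrite B1 C1 /= -(quotAlg_piM _ (tri_B 1) a) -quotAlg_piM tri_BaC linear0.
- apply: (num_indec_peirce (theta := thB) (i := i)) => // x.
  have [a ->] := quotAlg_pi_onto x; rewrite B1 -(quotAlg_piM _ (tri_B 1) a) -(quotAlg_piM _ a) => xl xr.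
  exists (quotAlg_pi e a.1.1); rewrite thBE -tri_Bcorner.
  by rewrite quotAlg_piM xl -quotAlg_piM xr.
- apply: (num_indec_peirce (theta := thC) (i := j)) => // x.
  have [a ->] := quotAlg_pi_onto x; rewrite C1 -(quotAlg_piM _ (tri_C 1) a) -(quotAlg_piM _ a) => xl xr.
  exists (quotAlg_pi e' a.2); rewrite thCE -tri_Ccorner.
  by rewrite quotAlg_piM xl -quotAlg_piM xr.
Qed.

End Triangular.

(** * Gluing along a left approximation *)

Section Gluing.
Variables (k : fieldType) (B C : fdAlgType k) (M : bimod C B).
Variables (X : rightMod B) (Y : rightMod C) (W : rightMod B).
Variable f : rhom (tensor_mod Y M) W.
Variables (e : B) (e' : C).
Hypotheses (XI : annihilates e X) (YI : annihilates e' Y).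
Hypothesis approx : min_left_approx (Fac X) f.

Local Notation A := (triAlg M : fdAlgType k).
Local Notation d := (tri_idem M e e').
Local Notation pi := (quotAlg_pi d).
Local Notation X0 := (triple_mod (zero_hom (tensor_mod (zero_mod C) M) X)).
Local Notation WY := (triple_mod f).

Lemma zero_mod_eq0 (z : zero_mod C) : z = 0.
Proof. exact: thinmx0. Qed.

(** The C-component is a module on the zero space, hence the constant 0. *)
Lemma X0_act (x : X0) (a : A) : ract x a = (ract x.1 a.1.1, 0) :> X0.
Proof.
congr (_, _); last exact: zero_mod_eq0.
by rewrite /= zero_lfunE addr0.
Qed.

Lemma WY_act (z : WY) (a : A) :
  ract z a = (ract z.1 a.1.1 + f (tensor z.2 a.1.2), ract z.2 a.2) :> WY.
Proof. by []. Qed.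

Lemma glue_tensor0 y : f (tensor y 0) = 0.
Proof. by rewrite tensor0r; exact: linear0. Qed.

Lemma WY_actB (z : WY) b : ract z (tri_B M b) = (ract z.1 b, 0) :> WY.
Proof. by rewrite WY_act tri_BE /= glue_tensor0 addr0 ract0r. Qed.
Lemma WY_actM (z : WY) m : ract z (tri_M M m) = (f (tensor z.2 m), 0) :> WY.
Proof. by rewrite WY_act tri_ME /= !ract0r add0r. Qed.
Lemma WY_actC (z : WY) c : ract z (tri_C M c) = (0, ract z.2 c) :> WY.
Proof. by rewrite WY_act tri_CE /= glue_tensor0 addr0 ract0r. Qed.

Let FacW : Fac X W. Proof. by case: approx => -[]. Qed.

Lemma annihilates_X0 : annihilates d X0.
Proof.
by move=> x a /ideal_tri_fst aI; rewrite X0_act XI.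
Qed.

Lemma annihilates_WY : annihilates d WY.
Proof.
apply: annihilates_of_idem => -[w y]; rewrite WY_act /= glue_tensor0.
have WI := annihilates_Fac XI FacW.
by rewrite (WI w) ?ideal_gen // (YI y) ?ideal_gen // addr0.
Qed.

Lemma annihilates_glued : annihilates d (sum_mod X0 WY).
Proof.
by move=> [x z] a aI; congr (_, _); [exact: annihilates_X0 | exact: annihilates_WY].
Qed.

Lemma lift_W (E : rightMod B) (g : rhom (tensor_mod Y M) E) :
  Fac X E -> exists h : rhom W E, forall t, h (f t) = g t.
Proof. by case: approx => -[_ lift] _ /lift; apply. Qed.

Lemma endo_W_bij (h : rhom W W) :
  (forall y m, h (f (tensor y m)) = f (tensor y m)) -> bijective h.
Proof.
case: approx => _ min hf; apply: min => t.
have lE : (h \o f)%VF = f.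
  by apply: tensor_ext => y m; rewrite comp_lfunE hf.
by rewrite -comp_lfunE lE.
Qed.

(** * Counting the summands of the glued module *)

Lemma num_indec_X0 n : num_indec (descend XI) n -> num_indec (descend annihilates_X0) n.
Proof.
have [th [thM thE _]] := quot_tri_B_ex M e e'.
have lin : linear (fun x : descend XI => (x, 0) : descend annihilates_X0).
  by move=> l u v; congr (_, _); rewrite /= scaler0 addr0.
have phiE x : lfun_of lin x = (x, 0) by exact: lfun_ofE.
have sur (z : descend annihilates_X0) : exists x, lfun_of lin x = z.
  case: z => x z; exists x; rewrite phiE; congr (_, _).
  by rewrite [z]zero_mod_eq0.
apply: (@num_indec_transfer _ _ _ th _ _ (lfun_of lin)) => //.
- by move=> x y; rewrite !phiE => -[].
- move=> x b; rewrite !phiE; have [b' ->] := quotAlg_pi_onto b.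
  by rewrite thE !descend_act X0_act tri_BE.
- move=> b; have [b0 b0E] := ascend_hom_ex b.
  have [h hE] : exists h : rhom X0 X0, forall z, h z = (b0 z.1, 0).
    apply: rhom_ext => [l u v | z a].
      by congr (_, _); rewrite /= ?linearP ?scaler0 ?addr0.
    by rewrite !X0_act /= rhomP.
  have [h' h'E] := descend_hom_ex annihilates_X0 annihilates_X0 h.
  by exists h' => y; rewrite h'E !phiE hE b0E.
move=> h hid; apply: inj_endo_bij => z; have [x <-] := sur z.
by rewrite hid.
Qed.

(** The approximation property lifts endomorphisms of Y to (W, Y)_f;
    minimality makes the endomorphisms over the identity of Y invertible. *)
Lemma WY_reflect (h : rhom (descend annihilates_WY) (descend annihilates_WY)) :
  (forall y : Y, h ((0, y) : WY) = ((0, y) : WY)) -> bijective h.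
Proof.
move=> hid0; have [h0 h0E] := ascend_hom_ex h.
have hid y : h0 (0, y) = (0, y) by rewrite h0E hid0.
have hW (w : W) : h0 (w, 0) = ((h0 (w, 0)).1, 0).
  have wE : (w, 0) = ract ((w, 0) : WY) (tri_B M 1).
    by rewrite WY_actB ract1.
  by rewrite {1}wE rhomP WY_actB ract1.
have [al alE] : exists al : rhom W W, forall w, al w = (h0 (w, 0)).1.
  apply: rhom_ext => [l u v | w b].
    have -> : (l *: u + v, 0) = l *: ((u, 0) : WY) + (v, 0) :> WY.
      by congr (_, _); rewrite /= scaler0 addr0.
    by rewrite linearP.
  have -> : (ract w b, 0) = ract ((w, 0) : WY) (tri_B M b) :> WY.
    by rewrite WY_actB.
  by rewrite rhomP WY_actB.
have bij_al : bijective al.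
  apply: endo_W_bij => y m; rewrite alE.
  have -> : (f (tensor y m), 0) = ract ((0, y) : WY) (tri_M M m) :> WY.
    by rewrite WY_actM.
  by rewrite rhomP hid WY_actM.
have bij0 : bijective h0.
  apply: inj_endo_bij => -[w y] h00.
  have wyE : (w, y) = ((w, 0) : WY) + ((0, y) : WY) :> WY.
    by congr (_, _); rewrite /= ?addr0 ?add0r.
  move: h00; rewrite {1}wyE rhomD hid hW -alE => -[/= alw y0].
  move: alw y0; rewrite addr0 add0r => alw ->.
  by congr (_, _); apply: (bij_inj bij_al); rewrite rhom0.
by apply: (eq_bij bij0) => z; exact: h0E.
Qed.

Lemma num_indec_WY n : num_indec (descend YI) n -> num_indec (descend annihilates_WY) n.
Proof.
have [th [thM thE _]] := quot_tri_C_ex M e e'.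
have lin : linear (fun y : descend YI => (0, y) : descend annihilates_WY).
  by move=> l u v; congr (_, _); rewrite /= scaler0 addr0.
have phiE y : lfun_of lin y = (0, y) by exact: lfun_ofE.
have th1 : th 1 = pi (tri_C M 1) by rewrite -thE.
apply: (@num_indec_transfer _ _ _ th _ _ (lfun_of lin)) => //.
- by move=> x y; rewrite !phiE => -[].
- move=> z; rewrite th1 descend_act WY_actC ract1 => <-.
  by exists z.2; rewrite phiE.
- move=> y b; rewrite !phiE; have [b' ->] := quotAlg_pi_onto b.
  by rewrite thE !descend_act WY_actC.
- move=> b; have [b0 b0E] := ascend_hom_ex b.
  have [g gE] : exists g : rhom (tensor_mod Y M) W, forall y m,
      g (tensor y m) = f (tensor (b0 y) m).
    apply: tensor_hom_ex => [m l u v | y l u v | y c m | y m a].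
    + by rewrite linearP tensor_linl linearP.
    + by rewrite tensor_linr linearP.
    + by rewrite rhomP tensor_balanced.
    + by rewrite -tensor_ract rhomP.
  have [al alE] := lift_W g FacW.
  have [h hE] : exists h : rhom WY WY, forall z, h z = (al z.1, b0 z.2).
    apply: rhom_ext => [l u v | z a].
      by congr (_, _); rewrite /= linearP.
    rewrite !WY_act /= rhomD !rhomP alE gE.
    by [].
  have [h' h'E] := descend_hom_ex annihilates_WY annihilates_WY h.
  by exists h' => y; rewrite h'E !phiE hE b0E rhom0.
by move=> h hid; apply: WY_reflect => y; rewrite -phiE hid.
Qed.

(** A common indecomposable summand T has T (0, 0, 1) = 0 as a summand of
    (X, 0), hence is zero as a summand of (W, Y)_f. *)
Lemma num_indec_glued m n :
  num_indec (descend XI) m -> num_indec (descend YI) n ->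
  num_indec (descend annihilates_glued) (m + n).
Proof.
move=> numX numY; pose Z1 := descend annihilates_X0; pose Z2 := descend annihilates_WY.
have iso : iso_mod (sum_mod Z1 Z2) (descend annihilates_glued).
  have [g gE] : exists g : rhom (sum_mod Z1 Z2) (descend annihilates_glued),
      forall z, g z = z by apply: rhom_ext.
  by exists g; exists id => z; rewrite gE.
apply: (num_indec_iso iso); apply: num_indec_sum => [T indT TX TW | | ].
- have [[t t0] _] := (indecomposableP T).1 indT; apply: t0.
  suff T0 : is_zero_mod T by exact: T0.
  have [th [thM thE _]] := quot_tri_C_ex M e e'.
  have th1 : th 1 = pi (tri_C M 1) by rewrite -thE.
  have refl (h : rhom Z2 Z2) :
      (forall z, ract z (th 1) = z -> h z = z) -> bijective h.
    move=> hid; apply: WY_reflect => y; apply: hid.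
    by rewrite th1 descend_act WY_actC ract1.
  apply: (retract_corner_neq0 refl TW) => {}t.
  case: TX => [i [p pK]]; rewrite -(pK t) -rhomP.
  suff -> : ract (i t) (th 1) = 0 by rewrite rhom0.
  by rewrite th1 descend_act X0_act tri_CE /= ract0r.
- exact: num_indec_X0.
- exact: num_indec_WY.
Qed.

(** * Rigidity of the glued module *)

Hypotheses (rigX : tau_rigid (descend XI)) (rigY : tau_rigid (descend YI)).

Local Notation ZI := (annihilates_glued).
Local Notation Z := (descend ZI).

Lemma glued_act (z : Z) (a : A) :
  ract z (pi a) = (ract z.1 a, ract z.2 a) :> sum_mod X0 WY.
Proof. exact: (descend_act ZI). Qed.

Let glue (x : X) (w : W) (y : Y) : Z := ((x, 0), (w, y)).

Lemma glue_eta (z : Z) : z = glue z.1.1 z.2.1 z.2.2.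
Proof.
by case: z => [[x x0] [w y]]; rewrite /glue (zero_mod_eq0 x0).
Qed.

Lemma glueD x w y x' w' y' :
  glue x w y + glue x' w' y' = glue (x + x') (w + w') (y + y').
Proof. by congr ((_, _), (_, _)); rewrite addr0. Qed.

Lemma glue_actB x w y b : ract (glue x w y) (pi (tri_B M b)) = glue (ract x b) (ract w b) 0.
Proof. by rewrite glued_act X0_act WY_actB tri_BE. Qed.
Lemma glue_actM x w y m : ract (glue x w y) (pi (tri_M M m)) = glue 0 (f (tensor y m)) 0.
Proof. by rewrite glued_act X0_act WY_actM tri_ME /= ract0r. Qed.
Lemma glue_actC x w y c : ract (glue x w y) (pi (tri_C M c)) = glue 0 0 (ract y c).
Proof. by rewrite glued_act X0_act WY_actC tri_CE /= ract0r. Qed.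

Fact piB_subproof : linear (fun b => pi (tri_B M b)).
Proof. by move=> l u v; rewrite !linearP. Qed.
Fact piC_subproof : linear (fun c => pi (tri_C M c)).
Proof. by move=> l u v; rewrite !linearP. Qed.
Let thB := lfun_of piB_subproof.
Let thC := lfun_of piC_subproof.
Let thBE b : thB b = pi (tri_B M b). Proof. exact: lfun_ofE. Qed.
Let thCE c : thC c = pi (tri_C M c). Proof. exact: lfun_ofE. Qed.
Let thBM a b : thB (a * b) = thB a * thB b.
Proof. by rewrite !thBE tri_BM quotAlg_piM. Qed.
Let thCM a b : thC (a * b) = thC a * thC b.
Proof. by rewrite !thCE tri_CM quotAlg_piM. Qed.

(** The corners E1 and E2 are extensions of X + W and of Y by modules in Fac X
    and in Fac Y. *)
Lemma glued_splits : splits_mod_Fac Z Z.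
Proof.
move=> E p n g /surj_homP p_onto gK.
pose E1 := corner thBM E; pose E2 := corner thCM E.
have E1I : annihilates e E1.
  move=> x b bI; apply: corner_val_inj; rewrite corner_val_act thBE corner_val0.
  suff /eqP -> : pi (tri_B M b) == 0 by exact: ract0r.
  rewrite quotv_pi_eq0 memv_preim; apply: (subvP _ _ bI).
  apply: ideal_min => [|a z|z a]; rewrite -!memv_preim.
  - exact: ideal_tri_B.
  - by rewrite tri_BM; exact: ideal_mull.
  - by rewrite tri_BM; exact: ideal_mulr.
have E2I : annihilates e' E2.
  move=> x b bI; apply: corner_val_inj; rewrite corner_val_act thCE corner_val0.
  suff /eqP -> : pi (tri_C M b) == 0 by exact: ract0r.
  rewrite quotv_pi_eq0 memv_preim; apply: (subvP _ _ bI).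
  apply: ideal_min => [|a z|z a]; rewrite -!memv_preim.
  - exact: ideal_tri_C.
  - by rewrite tri_CM; exact: ideal_mull.
  - by rewrite tri_CM; exact: ideal_mulr.
have WI := annihilates_Fac XI FacW.
have XWI : annihilates e (sum_mod X W).
  by move=> [x w] b bI; congr (_, _); [exact: XI | exact: WI].
have valB (x : E1) : ract (corner_val x) (pi (tri_B M 1)) = corner_val x.
  by rewrite -thBE corner_val1.
have valC (x : E2) : ract (corner_val x) (pi (tri_C M 1)) = corner_val x.
  by rewrite -thCE corner_val1.
have [p1 p1E] : exists p1 : rhom E1 (sum_mod X W), forall x,
    p (corner_val x) = glue (p1 x).1 (p1 x).2 0.
  have [p1 p1E] : exists p1 : rhom E1 (sum_mod X W), forall x,
      p1 x = ((p (corner_val x)).1.1, (p (corner_val x)).2.1).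
    apply: rhom_ext => [l u v | x b].
      by rewrite corner_val_linear linearP.
    rewrite corner_val_act rhomP thBE [p _]glue_eta glue_actB.
    by [].
  exists p1 => x; rewrite p1E -valB rhomP [p _]glue_eta glue_actB.
  by rewrite /= !ract1.
have [p2 p2E] : exists p2 : rhom E2 Y, forall x, p (corner_val x) = glue 0 0 (p2 x).
  have [p2 p2E] : exists p2 : rhom E2 Y, forall x,
      p2 x = (p (corner_val x)).2.2.
    apply: rhom_ext => [l u v | x b].
      by rewrite corner_val_linear linearP.
    rewrite corner_val_act rhomP thCE [p _]glue_eta glue_actC.
    by [].
  exists p2 => x; rewrite p2E -valC rhomP [p _]glue_eta glue_actC.
  by rewrite /= !ract1.
have genW (N : {vspace E1}) (h : rhom W E1) w :
    (forall v, h v \in N) -> generated X N (h w).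
  by move=> hN; apply: generated_map hN (Fac_generated w FacW).
(* The kernels of p1 and p2 are the corners of ker p, where a map out of Z
   splits into maps out of X, W and Y. *)
have kerB z : generated Z (lker p) z ->
    exists2 x : E1, corner_val x = ract z (pi (tri_B M 1))
      & generated X (lker p1) x.
  elim=> [|h u z' hK _ [x xE Gx]].
    by exists 0; [rewrite ract0l | exact: generated0].
  have [hX hXE] : exists hX : rhom X E1, forall x, corner_val (hX x) = h (glue x 0 0).
    apply: corner_hom_ex => [l v v' | v b].
      rewrite -linearP; congr (h _).
      by congr ((_, _), (_, _)); rewrite /= ?scaler0 ?addr0.
    by rewrite thBE -rhomP glue_actB ract0l.
  have [hW hWE] : exists hW : rhom W E1, forall w, corner_val (hW w) = h (glue 0 w 0).
    apply: corner_hom_ex => [l v v' | v b].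
      rewrite -linearP; congr (h _).
      by congr ((_, _), (_, _)); rewrite /= ?scaler0 ?addr0.
    by rewrite thBE -rhomP glue_actB ract0l.
  have hp v : p (h v) = 0 by apply/eqP; rewrite -memv_ker.
  have hXK v : hX v \in lker p1.
    rewrite memv_ker; have := p1E (hX v); rewrite hXE hp.
    by case: (p1 (hX v)) => a b [/= <- <-].
  have hWK v : hW v \in lker p1.
    rewrite memv_ker; have := p1E (hW v); rewrite hWE hp.
    by case: (p1 (hW v)) => a b [/= <- <-].
  exists (hX u.1.1 + (hW u.2.1 + x)).
    have vD (x1 x2 : E1) : corner_val (x1 + x2) = corner_val x1 + corner_val x2.
      by [].
    rewrite !vD xE hXE hWE addrA -rhomD glueD addr0 add0r ractDl; congr (_ + _).
    by rewrite -rhomP [in RHS](glue_eta u) glue_actB !ract1 addr0.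
  apply: generated_add; first exact: generated_hom.
  by apply: generated_add => //; exact: genW.
have kerC z : generated Z (lker p) z ->
    exists2 x : E2, corner_val x = ract z (pi (tri_C M 1))
      & generated Y (lker p2) x.
  elim=> [|h u z' hK _ [x xE Gx]].
    by exists 0; [rewrite ract0l | exact: generated0].
  have [hY hYE] : exists hY : rhom Y E2, forall y, corner_val (hY y) = h (glue 0 0 y).
    apply: corner_hom_ex => [l v v' | v b].
      rewrite -linearP; congr (h _).
      by congr ((_, _), (_, _)); rewrite /= ?scaler0 ?addr0.
    by rewrite thCE -rhomP glue_actC.
  have hp v : p (h v) = 0 by apply/eqP; rewrite -memv_ker.
  have hYK v : hY v \in lker p2.
    by rewrite memv_ker; have := p2E (hY v); rewrite hYE hp => -[<-].
  exists (hY u.2.2 + x); last by apply: generated_add => //; exact: generated_hom.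
  have vD (x1 x2 : E2) : corner_val (x1 + x2) = corner_val x1 + corner_val x2.
    by [].
  rewrite vD xE hYE ractDl; congr (_ + _).
  by rewrite -rhomP [in RHS](glue_eta u) glue_actC !ract1.
have genK z : p z = 0 -> generated Z (lker p) z.
  by move=> pz; rewrite -gK; apply: generated_limg; rewrite gK memv_ker pz.
have ker1 x : p1 x = 0 -> generated X (lker p1) x.
  move=> p1x; have [|y] := kerB (corner_val x); last first.
    by rewrite valB => /corner_val_inj ->.
  by apply: genK; rewrite p1E p1x.
have ker2 x : p2 x = 0 -> generated Y (lker p2) x.
  move=> p2x; have [|y] := kerC (corner_val x); last first.
    by rewrite valC => /corner_val_inj ->.
  by apply: genK; rewrite p2E p2x.
have p1_onto z : z \in limg p1.
  have [t tE] := p_onto (glue z.1 z.2 0).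
  have [|x xE] := @corner_val_onto _ _ _ thB thBM E (ract t (pi (tri_B M 1))).
    by rewrite -ractM thBE -quotAlg_piM -tri_BM mulr1.
  apply/memv_imgP; exists x; rewrite ?memvf //.
  have := p1E x; rewrite xE rhomP tE glue_actB !ract1.
  by case: z {tE} => a b; case: (p1 x) => a' b' [-> ->].
have p2_onto y : y \in limg p2.
  have [t tE] := p_onto (glue 0 0 y).
  have [|x xE] := @corner_val_onto _ _ _ thC thCM E (ract t (pi (tri_C M 1))).
    by rewrite -ractM thCE -quotAlg_piM -tri_CM mulr1.
  apply/memv_imgP; exists x; rewrite ?memvf //.
  by have := p2E x; rewrite xE rhomP tE glue_actC ract1 => -[].
have liftX (t : rhom X (sum_mod X W)) : exists s : rhom X E1, forall x, p1 (s x) = t x.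
  by apply: (descend_lifts E1I XWI rigX ker1) => v; exact: p1_onto.
have [jX jXE] := inl_rhom_ex X W; have [jW jWE] := inr_rhom_ex X W.
have [s0 s0E] := liftX jX.
have [s2 s2E] : exists s : rhom Y E2, forall y, p2 (s y) = id_rhom Y y.
  by apply: (descend_lifts E2I YI rigY ker2) => v; exact: p2_onto.
(* Fac X is closed under extensions by modules in Fac X: maps X -> X + W lift
   to E1, and their lifts together with ker p1 generate it. *)
have FacE1 : Fac X E1.
  apply: generated_Fac => x.
  have liftW w : exists2 x' : E1, generated X fullv x' & p1 x' = jW w.
    elim: (Fac_generated w FacW) => [|h u w' _ _ [x' Gx' x'E]].
      by exists 0; [exact: generated0 | rewrite !rhom0].
    have [s sE] := liftX (comp_rhom jW h); exists (s u + x').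
      by apply: generated_add => //; apply: generated_hom => v; exact: memvf.
    by rewrite rhomD x'E sE comp_rhomE rhomD.
  have [x' Gx' x'E] := liftW (p1 x).2.
  have -> : x = s0 (p1 x).1 + (x' + (x - (s0 (p1 x).1 + x'))).
    by rewrite addrA addrC subrK.
  apply: generated_add; first by apply: generated_hom => v; exact: memvf.
  apply: generated_add => //; apply: (generated_sub (subvf (lker p1))).
  apply: ker1; rewrite rhomB rhomD s0E x'E jXE jWE.
  by case: (p1 x) => a b; congr (_, _); rewrite /= ?addr0 ?add0r subrr.
have [G GE] : exists G : rhom (tensor_mod Y M) E1, forall y m,
    corner_val (G (tensor y m)) = ract (corner_val (s2 y)) (pi (tri_M M m)).
  pose G0 y m : E1 :=
    vsproj (corner_space thB E) (ract (corner_val (s2 y)) (pi (tri_M M m))).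
  have G0E y m : corner_val (G0 y m) = ract (corner_val (s2 y)) (pi (tri_M M m)).
    rewrite /corner_val /restrict_val vsprojK //; apply/(corner_spaceP thBM).
    by rewrite thBE -ractM -quotAlg_piM tri_MB ract1.
  have [|||| G GE] := @tensor_hom_ex _ _ _ Y M E1 G0.
  - move=> m l u v; apply: corner_val_inj; rewrite corner_val_linear !G0E.
    by rewrite linearP corner_val_linear ractDl ractZl.
  - move=> y l u v; apply: corner_val_inj; rewrite corner_val_linear !G0E.
    by rewrite 2!linearP ractDr ractZr.
  - move=> y c m; apply: corner_val_inj; rewrite !G0E rhomP corner_val_act thCE.
    by rewrite -ractM -quotAlg_piM tri_CMM.
  - move=> y m b; apply: corner_val_inj; rewrite corner_val_act !G0E thBE.
    by rewrite -ractM -quotAlg_piM tri_MB.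
  by exists G => y m; rewrite GE G0E.
(* p1 s1 : W -> X + W fixes f in its W-component h; its X-component kills the
   image of f but may be nonzero, so (s0, s1, s2) is a section only up to the
   automorphism p S. *)
have [s1 s1E] := lift_W G FacE1.
have [q2 q2E] := snd_rhom_ex X W.
have bij_h : bijective (comp_rhom q2 (comp_rhom p1 s1)).
  apply: (endo_W_bij) => y m; rewrite !comp_rhomE s1E q2E.
  have := p1E (G (tensor y m)); rewrite GE rhomP p2E glue_actM.
  by rewrite s2E id_rhomE; case: (p1 _) => a b [_ ->].
have vD1 (x1 x2 : E1) : corner_val (x1 + x2) = corner_val x1 + corner_val x2.
  by [].
pose S0 (z : Z) : E :=
  corner_val (s0 z.1.1) + corner_val (s1 z.2.1) + corner_val (s2 z.2.2).
have [S SE] : exists S : rhom Z E, forall z, S z = S0 z.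
  apply: rhom_ext => [l u v | z q].
    rewrite /S0 /= !linearP !corner_val_linear !scalerDr [RHS]addrACA.
    by congr (_ + _); rewrite [RHS]addrACA.
  have [a ->] := quotAlg_pi_onto q.
  have actB (x : E1) : ract (corner_val x) (pi a) =
      ract (corner_val x) (pi (tri_B M a.1.1)).
    by rewrite -tri_Bl quotAlg_piM ractM valB.
  have actC (x : E2) : ract (corner_val x) (pi a) =
      ract (corner_val x) (pi (tri_M M a.1.2)) +
      ract (corner_val x) (pi (tri_C M a.2)).
    have piD (r s : A) : pi (r + s) = pi r + pi s by exact: linearD.
    by rewrite -ractDr -piD -tri_Cl quotAlg_piM ractM valC.
  rewrite /S0 !ractDl !actB actC glued_act X0_act WY_act /=.
  rewrite (rhomP s0) (rhomD s1) (rhomP s1) (rhomP s2) s1E vD1 GE.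
  by rewrite !corner_val_act !thBE thCE !addrA.
have bij : bijective (comp_rhom p S).
  apply: inj_endo_bij => z; rewrite comp_rhomE SE /S0 !rhomD !p1E p2E s0E jXE s2E.
  rewrite !glueD !(addr0, add0r) id_rhomE /= => -[xk hw y0].
  have w0 : z.2.1 = 0.
    by apply: (bij_inj bij_h); rewrite rhom0 !comp_rhomE q2E.
  have p10 : p1 (s1 z.2.1) = 0 by rewrite w0 (rhom0 s1) (rhom0 p1).
  move: xk; rewrite p10 addr0 => x0.
  by rewrite (glue_eta z) x0 w0 y0.
have [r [rK Kr]] := inv_rhom bij.
by exists (comp_rhom S r) => v; rewrite comp_rhomE -comp_rhomE Kr.
Qed.

End Gluing.

Theorem theorem1p2 (k : fieldType) (B C : fdAlgType k) (M : bimod C B)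
    (X : rightMod B) (Y : rightMod C)
    (XY : rightMod B) (f : rhom (tensor_mod Y M) XY) :
  support_tau_tilting X ->
  support_tau_tilting Y ->
  min_left_approx (Fac X) f ->
  @support_tau_tilting k (triAlg M)
    (sum_mod (triple_mod (zero_hom (tensor_mod (zero_mod C) M) X))
             (triple_mod f)).
Proof.
move=> [e [XI [ee [rigX [m [numX numB]]]]]] [e' [YI [ee' [rigY [n [numY numC]]]]]].
move=> approx; exists (tri_idem M e e'), (annihilates_glued XI YI approx).
split; first exact: tri_idem_idem.
split; first exact/splits_tau_rigid/glued_splits.
by exists (m + n)%N; split; [exact: num_indec_glued | exact: num_indec_tri_quot].
Qed.
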